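(* Consider the two-dimensional ($n=2$) restricted Euler–Poisson equations, whose spectral form is $$\partial_t\rho+u\cdot\nabla\rho+\rho(\lambda_1+\lambda_2)=0,\qquad \partial_t\lambda_i+u\cdot\nabla\lambda_i+\lambda_i^2=\frac{k\rho}{2},\quad i=1,2,$$ with smooth initial data. If both $\lambda_i(\cdot,0)$, $i=1,2$, are complex, i.e. $\operatorname{Im}(\lambda_i(\alpha,0))\neq0$ for all $\alpha\in\mathbb{R}^2$, then the solution remains smooth for all time $t>0$.
   Context: The restricted Euler–Poisson system in $\mathbb{R}^n$ is $\partial_tM+u\cdot\nabla M+M^2=\frac{k}{n}\rho I_{n\times n}$, $\partial_t\rho+u\cdot\nabla\rho+\rho\operatorname{tr}M=0$, where $M=\nabla u$ is the (real) velocity gradient, $\rho\ge0$ the density and $k$ a real constant. $\lambda_1,\dots,\lambda_n$ denote the eigenvalues of $M$. Along particle paths $\frac{dx}{dt}=u(x,t)$, $x(\alpha,0)=\alpha$, the spectral equations form a closed ODE system for $(\rho,\lambda_1,\dots,\lambda_n)$. By a standard continuation argument, smoothness of the solution is equivalent to $\lambda_1,\lambda_2$ remaining bounded along particle paths on bounded time intervals. *)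

(* Defs.v *)
From HB Require Import structures.
From mathcomp Require Export all_boot all_order all_algebra.
From mathcomp Require Export all_classical all_reals all_analysis.
From mathcomp Require Export complex.
Export Order.TTheory GRing.Theory Num.Theory.
Export numFieldNormedType.Exports.

Set Implicit Arguments.
Unset Strict Implicit.
Unset Printing Implicit Defensive.

Local Open Scope classical_set_scope.
Local Open Scope ring_scope.
Local Open Scope complex_scope.

Section Smoothness.
Context {R : realType} {E W : normedModType R}.
Implicit Types (D : set E) (f : E -> W) (p v : E).

(* The library's [derivable f p v] and ['D_v f p], with the increment h
   restricted to those for which p + h v stays in D.  For D = setT this is the
   library notion; on a time boundary it is the one-sided derivative. *)
Definition derivable_in D f p v :=
  cvg (h^-1 *: (f (h *: v + p) - f p) @[h --> within [set h | D (h *: v + p)] 0^']).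

Definition derive_in D f v p : W :=
  lim (h^-1 *: (f (h *: v + p) - f p) @[h --> within [set h | D (h *: v + p)] 0^']).

(* f is C^n on D: all iterated directional derivatives of order <= n exist on D
   and are continuous on D (up to the boundary points belonging to D).  Meant
   for E of finite dimension. *)
Fixpoint Ck_in (n : nat) D f : Prop :=
  {within D, continuous f} /\
  (if n is m.+1 then
     forall v, (forall p, D p -> derivable_in D f p v) /\
               Ck_in m D (derive_in D f v)
   else True).

Definition smooth_in D f := forall n, Ck_in n D f.

End Smoothness.

Section ComplexValued.
Context {R : realType} {E : normedModType R}.
Implicit Types (D : set E) (z : E -> R[i]).

Definition CkC_in (n : nat) D z :=
  Ck_in n D (fun p => complex.Re (z p)) /\ Ck_in n D (fun p => complex.Im (z p)).

Definition smoothC_in D z := forall n, CkC_in n D z.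

Definition deriveC_in D z (v p : E) : R[i] :=
  derive_in D (fun q => complex.Re (z q)) v p +i*
  derive_in D (fun q => complex.Im (z q)) v p.

End ComplexValued.

Section RestrictedEulerPoisson.
Context {R : realType}.

Notation space := 'rV[R]_2.
Notation spacetime := (R * 'rV[R]_2)%type.

Definition slab (I : set R) : set spacetime := [set p | I p.1].

Definition et : spacetime := (1, 0).
Definition ex (j : 'I_2) : spacetime := (0, delta_mx 0 j).

(* (grad u)_ij = d u_i / d x_j *)
Definition grad (u : space -> space) (x : space) : 'M[R]_2 :=
  \matrix_(i < 2, j < 2) 'D_(delta_mx 0 j) (fun y => u y 0 i) x.

(* z 0, z 1 are the eigenvalues of the real matrix A, with multiplicity *)
Definition eigenvalues_of (A : 'M[R]_2) (z : 'I_2 -> R[i]) :=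
  char_poly (map_mx (real_complex R) A) = \prod_(i < 2) ('X - (z i)%:P).

Section Eulerian.
Variables (k : R) (I : set R) (u : spacetime -> space).
Variables (rho : spacetime -> R) (lam : 'I_2 -> spacetime -> R[i]).
Notation D := (slab I).

Definition spectral_solution :=
  [/\ Ck_in 1 D rho,
      forall i, CkC_in 1 D (lam i),
      forall p, D p ->
        (derive_in D rho et p + \sum_j u p 0 j * derive_in D rho (ex j) p)%:C
        + (rho p)%:C * (lam 0 p + lam 1 p) = 0
    & forall i p, D p ->
        deriveC_in D (lam i) et p
        + \sum_j (u p 0 j)%:C * deriveC_in D (lam i) (ex j) p
        + lam i p ^+ 2 = (k * rho p / 2)%:C].

Definition particle_path (alpha : space) (x : R -> space) :=
  x 0 = alpha /\
  forall t, I t -> derivable_in I x t 1 /\ derive_in I x 1 t = u (t, x t).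

End Eulerian.

(* The closed system along particle paths: the fields are functions of time and
   of the label alpha of the path, and d/dt along a path is the partial
   derivative at fixed label. *)
Definition lagrangian_solution (k : R) (I : set R) (rho : spacetime -> R)
    (M : spacetime -> 'M[R]_2) (lam : 'I_2 -> spacetime -> R[i]) :=
  let D := slab I in
  forall p, D p ->
  [/\ 0 <= rho p,
      derive_in D M et p + M p *m M p = (k / 2 * rho p) *: 1%:M,
      derive_in D rho et p + rho p * \tr (M p) = 0,
      eigenvalues_of (M p) (lam^~ p)
    & (derive_in D rho et p)%:C + (rho p)%:C * (lam 0 p + lam 1 p) = 0 /\
      forall i, deriveC_in D (lam i) et p + lam i p ^+ 2 = (k * rho p / 2)%:C].

End RestrictedEulerPoisson.

(* Main.v *)
Require Import Defs.
From mathcomp Require Import ring lra.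

(* A non-real spectrum of a real matrix is a conjugate pair a +- i b, and along a
   particle path a' = - a^2 + b^2 + k rho / 2, b' = - 2 a b, rho' = - 2 a rho.  With
   a = r'/r and r(0) = 1 this gives b = b0 / r^2, rho = rho0 / r^2 and the radial
   equation r'' = b0^2 / r^3 + c / r with c = k rho0 / 2.  The centrifugal barrier
   b0^2 / (2 r^2) dominates the logarithmic potential, so conservation of energy keeps
   r away from 0; the truncated, globally Lipschitz equation is solved by Picard
   iteration on the whole time axis.  The velocity gradient is
   M = a I + r^-2 (M0 - a0 I), by Cayley-Hamilton.

   Smooth dependence on the initial data uses that the system is quadratic: the
   difference quotients in the initial data are uniformly Cauchy by Gronwall's
   inequality, and a field together with its directional derivative again solves a
   quadratic system, so that the order of differentiability is raised by induction.

   A classical solution satisfies the same quadratic system along its particle paths,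
   by the chain rule, hence agrees with the solution above by Gronwall. *)

Set Implicit Arguments.
Unset Strict Implicit.
Unset Printing Implicit Defensive.

Local Open Scope classical_set_scope.
Local Open Scope ring_scope.
Local Open Scope complex_scope.

(** * Differential inequalities *)

(** Subtracting two solutions of a quadratic system leaves an equation exactly linear in the
    difference, so difference quotients satisfy linear equations without any Taylor remainder.
    Lower-order terms become quadratic once the constant 1 is carried as an unknown. Gronwall's
    constant depends on bounds for the solutions, so global existence for each label is not enough:
    the bounds must be locally uniform in the label. This is why the barrier estimate takes the
    explicit form of [radius_bound] and [rate_bound], which are continuous in the data where b0 is
    nonzero. The sign of k is arbitrary. For c < 0 the potential [- c ln r] tends to -oo as r -> 0,
    more slowly than the barrier grows. In general r has no upper bound, so the quantities estimated
    are 1/r and r'/r. Solving for negative times as well keeps all derivatives at t = 0 two-sided;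
    regularity on the slab t >= 0 then follows by restriction. *)

Section ScalarCalculus.
Context {R : realType}.
Implicit Types (f g : R -> R) (a b t x : R).

Lemma is_derive_continuous f df t : is_derive t 1 f df -> {for t, continuous f}.
Proof.
by move=> [dft _]; apply: differentiable_continuous; exact/derivable1_diffP.
Qed.

Lemma is_derive_within_continuous f (df : R -> R) (A : set R) :
  (forall t, is_derive t 1 f (df t)) -> {within A, continuous f}.
Proof.
by move=> fdf; apply: continuous_subspaceT => t; exact: is_derive_continuous.
Qed.

Lemma is_derive_le f g (df dg : R -> R) a b : a <= b ->
  (forall t, a < t < b -> is_derive t 1 f (df t)) ->
  (forall t, a < t < b -> is_derive t 1 g (dg t)) ->
  (forall t, a < t < b -> df t <= dg t) ->
  {within `[a, b], continuous f} -> {within `[a, b], continuous g} ->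
  f b - f a <= g b - g a.
Proof.
rewrite le_eqVlt => /predU1P[-> *|ab fdf gdg dfg cf cg]; first by rewrite !subrr.
have cgf : {within `[a, b], continuous (g - f)}.
  by move=> x; apply: cvgB; [exact: cg|exact: cf].
have [|c /[!in_itv]/= cab] := @MVT R (g - f) (dg - df) a b ab _ cgf.
  move=> x; rewrite in_itv/= => xab.
  by apply: is_deriveB; [exact: gdg|exact: fdf].
rewrite -[(g - f) b]/(g b - f b) -[(g - f) a]/(g a - f a).
rewrite -[(dg - df) c]/(dg c - df c) => E.
suff : 0 <= (dg c - df c) * (b - a) by lra.
by rewrite mulr_ge0// subr_ge0 ?dfg// ltW.
Qed.

Lemma is_derive_norm_le f g (df dg : R -> R) a b : a <= b ->
  (forall t, a < t < b -> is_derive t 1 f (df t)) ->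
  (forall t, a < t < b -> is_derive t 1 g (dg t)) ->
  (forall t, a < t < b -> `|df t| <= dg t) ->
  {within `[a, b], continuous f} -> {within `[a, b], continuous g} ->
  `|f b - f a| <= g b - g a.
Proof.
move=> ab fdf gdg dfg cf cg; rewrite ler_norml; apply/andP; split.
  have -> : f b - f a = - ((- f) b - (- f) a).
    by rewrite -[(- f) b]/(- f b) -[(- f) a]/(- f a); lra.
  rewrite lerN2; apply: (is_derive_le (df := - df) (dg := dg)) => //.
  - by move=> t tab; apply: is_deriveN; exact: fdf.
  - by move=> t /dfg; rewrite ler_norml => /andP[+ _]; rewrite -[(- df) t]/(- df t); lra.
  - by move=> x; apply: cvgN; exact: cf.
apply: (is_derive_le (df := df) (dg := dg)) => //.
by move=> t /dfg; rewrite ler_norml => /andP[].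
Qed.

Lemma is_derive_zero_cst f a b : a <= b ->
  (forall t, a < t < b -> is_derive t 1 f 0) ->
  {within `[a, b], continuous f} -> f b = f a.
Proof.
move=> ab fdf cf; apply/eqP; rewrite -subr_eq0 -normr_le0.
have -> : 0 = cst 0 b - cst 0 a :> R by rewrite /cst subrr.
apply: (is_derive_norm_le (df := cst 0) (dg := cst 0)) => //.
- by move=> t _; rewrite /cst normr0.
- by move=> x; exact: cst_continuous.
Qed.

Lemma is_derive_comp_opp f (df : R -> R) t :
  is_derive (- t) 1 f (df (- t)) -> is_derive t 1 (fun s => f (- s)) (- df (- t)).
Proof.
move=> fdf; rewrite -mulrN1.
by apply: (@is_derive1_comp R f -%R); apply: is_deriveNid.
Qed.

(** Integration gains a factor [1 / mu] in the norm weighted by the exponential; for large [mu] this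
    makes Picard's map a contraction on the whole line at once. *)
Lemma derive_expR_bound f (df : R -> R) (C mu : R) : 0 < mu ->
  (forall t, is_derive t 1 f (df t)) -> f 0 = 0 ->
  (forall t, `|df t| <= C * expR (mu * `|t|)) ->
  forall t, `|f t| <= C / mu * expR (mu * `|t|).
Proof.
move=> mu0.
have C0 (h : R -> R) : (forall t, `|h t| <= C * expR (mu * `|t|)) -> 0 <= C.
  by move=> /(_ 0); rewrite normr0 mulr0 expR0 mulr1; exact: le_trans.
have pos (h dh : R -> R) : (forall t, is_derive t 1 h (dh t)) -> h 0 = 0 ->
    (forall t, `|dh t| <= C * expR (mu * `|t|)) ->
    forall t, 0 <= t -> `|h t| <= C / mu * expR (mu * t).
  move=> hdh h0 dhC t t0.
  pose g s := C / mu * expR (mu * s).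
  have gdg (s : R) : is_derive s 1 g (C * expR (mu * s)).
    rewrite /g; apply: is_derive_eq.
    by rewrite /GRing.scale/=; field; rewrite gt_eqF.
  have := @is_derive_norm_le h g dh (fun s => C * expR (mu * s)) 0 t t0.
  rewrite h0 subr0 => /(_ _ _ _ _ _)/le_trans; apply => //.
  - by move=> s /andP[s0 _]; rewrite -[X in expR (mu * X)](gtr0_norm s0).
  - exact: is_derive_within_continuous hdh.
  - exact: is_derive_within_continuous gdg.
  - by rewrite gerBl /g mulr0 expR0 mulr1 divr_ge0 ?(ltW mu0)// (C0 dh).
move=> fdf f0 dfC t; case: (leP 0 t) => t0; first by rewrite (ger0_norm t0) (pos f df).
rewrite (ltr0_norm t0).
have fN (s : R) : is_derive s 1 (fun s => f (- s)) (- df (- s)).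
  exact: is_derive_comp_opp.
have dfN s : `|- df (- s)| <= C * expR (mu * `|s|).
  by rewrite normrN -[in leRHS]normrN.
have f0N : f (- 0) = 0 by rewrite oppr0.
have tN : 0 <= - t by rewrite oppr_ge0 ltW.
by have := pos _ _ fN f0N dfN _ tN; rewrite opprK.
Qed.

(** The integral starts at a base point left of its end point, and no base point serves the whole
    line. The base [- n] therefore moves with the end point; subtracting the value at 0 removes the
    dependence on [n]. *)
Lemma antiderivative f : continuous f ->
  exists F : R -> R, F 0 = 0 /\ forall t, is_derive t 1 F (f t).
Proof.
move=> cf.
pose G (n x : R) := (\int[lebesgue_measure]_(s in [set` `[- n, x]]) f s)%R.
have Gd n x : - n < x -> is_derive x 1 (G n) (f x).
  move=> nx.
  have [|||dG <-] := @continuous_FTC1_closed R f (- n) x (x + 1) _ _ nx _.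
  - by rewrite ltrDl.
  - apply: continuous_compact_integrable; first exact: segment_compact.
    exact: continuous_subspaceT.
  - exact: cf.
  - by rewrite derive1E; exact: derivableP.
have Gagree n m x : 0 < n -> - n < x -> n <= m -> G n x - G n 0 = G m x - G m 0.
  move=> n0 nx nm.
  have dz t : - n < t -> is_derive t 1 (G n - G m) 0.
    move=> nt; rewrite -(subrr (f t)).
    by apply: is_deriveB; apply: Gd => //; apply: le_lt_trans nt; rewrite lerN2.
  have cz a b : - n < a -> {within `[a, b], continuous (G n - G m)}.
    move=> na; apply: continuous_in_subspaceT => t /[!inE]/= /[!in_itv]/= /andP[ta _].
    by apply: is_derive_continuous; apply: dz; exact: lt_le_trans ta.
  suff : (G n - G m) x = (G n - G m) 0.
    by rewrite -[(_ - _) x]/(_ x - _ x) -[(_ - _) 0]/(_ 0 - _ 0); lra.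
  have n0' : - n < 0 by rewrite oppr_lt0.
  case: (leP 0 x) => x0.
    apply: is_derive_zero_cst => //; last exact: cz.
    by move=> t /andP[t0 _]; apply: dz; exact: lt_trans t0.
  apply/esym/is_derive_zero_cst; [exact: ltW| |exact: cz].
  by move=> t /andP[t0 _]; apply: dz; exact: lt_trans t0.
exists (fun x => G (`|x| + 1) x - G (`|x| + 1) 0); split; first by rewrite subrr.
(* This [n] dominates [|x| + 1] for all x within 1 of t, so near t the function coincides with one
   integral of fixed base. *)
move=> t; set n := `|t| + 2.
have n0 : 0 < n by rewrite /n; have := normr_ge0 t; lra.
apply: (@near_eq_is_derive _ _ _ (fun x => G n x - G n 0)).
  have : \forall x \near t, `|t - x| < 1.
    by move: (@cvg_id _ (nbhs t)) => /cvgrPdist_lt; apply.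
  apply: filterS => x tx; apply/esym/Gagree.
  - by rewrite ltr_wpDl.
  - by have := ler_norm (- x); rewrite normrN; lra.
  - have := ler_normD (t - x) (- t); rewrite normrN (_ : t - x - t = - x); last by lra.
    by rewrite normrN /n; lra.
rewrite -[f t]subr0; apply: is_deriveB; apply: Gd.
by rewrite /n; have := ler_norm (- t); rewrite normrN; lra.
Qed.

End ScalarCalculus.

Section BigSums.
Context {R : realType} {V W : normedModType R}.

Lemma is_derive_bigsum (I : Type) (r : seq I) (f : I -> V -> W) (df : I -> W) x v :
  (forall i, is_derive x v (f i) (df i)) ->
  is_derive x v (fun y => \sum_(i <- r) f i y) (\sum_(i <- r) df i).
Proof.
move=> fdf; elim: r => [|i r IH].
  rewrite big_nil (_ : (fun _ => _) = cst 0); first exact: is_derive_cst.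
  by apply/funext => y; rewrite big_nil.
rewrite big_cons (_ : (fun _ => _) = f i + fun y => \sum_(i <- r) f i y).
  exact: is_deriveD.
by apply/funext => y; rewrite big_cons.
Qed.

Lemma cvg_bigsum (T : Type) (F : set_system T) (FF : Filter F) (I : Type)
    (r : seq I) (f : I -> T -> W) (l : I -> W) :
  (forall i, f i x @[x --> F] --> l i) ->
  \sum_(i <- r) f i x @[x --> F] --> \sum_(i <- r) l i.
Proof.
move=> fl; elim: r => [|i r IH].
  rewrite big_nil; under eq_fun do rewrite big_nil.
  exact: cvg_cst.
rewrite big_cons; under eq_fun do rewrite big_cons.
exact: cvgD.
Qed.

Lemma cvg_bigsum0 (T : Type) (F : set_system T) (FF : Filter F) (I : Type)
    (r : seq I) (f : I -> T -> W) :
  (forall i, f i x @[x --> F] --> 0) -> \sum_(i <- r) f i x @[x --> F] --> 0.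
Proof.
move=> fl; rewrite -[X in _ --> X](_ : \sum_(i <- r) 0 = 0); last by rewrite big1.
exact: cvg_bigsum.
Qed.

End BigSums.

(** * Gronwall's inequality for finite families *)

Section Gronwall.
Context {R : realType} {I : finType}.
Implicit Types (d dd : I -> R -> R) (L eps T : R).

(** With n the cardinality, N the sum of squares and S the sum of absolute values, [2 L n] comes
    from S^2 <= n N, and [n + 1] covers 2 eps S <= n eps^2 + N. *)
Definition gronwall_rate L : R := 2 * L * #|I|%:R + #|I|%:R + 1.

(** The sum of squares N is differentiable where absolute values are not: N + eps^2 grows at most at
    the given rate, so its product with the decaying exponential is nonincreasing. Derivatives are
    required only inside the interval, which admits solutions known on one side of time 0 only. *)
Lemma gronwall d dd L eps T : 0 <= L -> 0 <= eps ->
  (forall i t, 0 < t < T -> is_derive t 1 (d i) (dd i t)) ->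
  (forall i, {within `[0, T], continuous (d i)}) ->
  (forall i t, 0 < t < T -> `|dd i t| <= L * (\sum_j `|d j t|) + eps) ->
  forall i t, 0 <= t <= T ->
  `|d i t| <= expR (gronwall_rate L * t) * (\sum_j `|d j 0| + eps).
Proof.
move=> L0 e0 ddd cd ddL i t /andP[t0 tT].
pose N s : R := \sum_j d j s ^+ 2.
pose n : R := #|I|%:R.
set c := gronwall_rate L.
have n0 : 0 <= n by rewrite ler0n.
have c0 : 0 <= c by rewrite /c /gronwall_rate -/n; have := mulr_ge0 L0 n0; lra.
have N0 s : 0 <= N s by apply: sumr_ge0 => j _; exact: sqr_ge0.
have sum1 (x : R) : \sum_(j : I) x = n * x.
  by rewrite sumr_const /n mulr_natl.
pose h s := (N s + eps ^+ 2) * expR (- (c * s)).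
pose dN s : R := \sum_j 2 * (d j s * dd j s).
have dN_ s : 0 < s < T -> is_derive s 1 N (dN s).
  move=> sT; apply: is_derive_bigsum => j; have dj := ddd j s sT.
  have -> : (fun y => d j y ^+ 2) = d j * d j by apply/funext => y; rewrite expr2.
  by apply: is_derive_eq; rewrite /GRing.scale/=; ring.
have dNle s : 0 < s < T -> dN s <= c * (N s + eps ^+ 2).
  move=> sT; set S := \sum_j `|d j s|.
  have S0 : 0 <= S by exact: sumr_ge0.
  have S2 : S ^+ 2 <= n * N s.
    have -> : S ^+ 2 = \sum_j \sum_k `|d j s| * `|d k s|.
      by rewrite expr2 mulr_suml; apply: eq_bigr => j _; rewrite mulr_sumr.
    have -> : n * N s = \sum_j \sum_k (d j s ^+ 2 / 2 + d k s ^+ 2 / 2).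
      under eq_bigr do rewrite big_split/= sum1 -mulr_suml -/(N s).
      by rewrite big_split/= sum1 -mulr_sumr -mulr_suml -/(N s); lra.
    apply: ler_sum => j _; apply: ler_sum => k _.
    rewrite -(real_normK (num_real (d j s))) -(real_normK (num_real (d k s))).
    by have := sqr_ge0 (`|d j s| - `|d k s|); nra.
  have S1 : 2 * eps * S <= n * eps ^+ 2 + N s.
    rewrite mulr_sumr -sum1 -big_split/=; apply: ler_sum => j _.
    rewrite -(real_normK (num_real (d j s))).
    by have := sqr_ge0 (`|d j s| - eps); nra.
  apply: (@le_trans _ _ (2 * (L * S + eps) * S)).
    rewrite mulr_sumr; apply: ler_sum => j _.
    apply: le_trans (ler_norm _) _; rewrite !normrM.
    have -> : `|2| = 2 :> R by rewrite ger0_norm.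
    have := ler_wpM2l (normr_ge0 (d j s)) (ddL j s sT); rewrite -/S; lra.
  have LS : 2 * L * S ^+ 2 <= 2 * L * (n * N s) by rewrite ler_wpM2l// mulr_ge0.
  have := mulr_ge0 (mulr_ge0 L0 n0) (sqr_ge0 eps).
  have := mulr_ge0 n0 (N0 s); have := sqr_ge0 eps.
  by rewrite /c /gronwall_rate -/n; nra.
have cN : {within `[0, T], continuous N}.
  move=> x; apply: cvg_bigsum => j.
  exact: (cvgM (cd j x) (cd j x)).
have cexp : {within `[0, T], continuous (fun s => expR (- (c * s)))}.
  apply: continuous_subspaceT => s.
  have : is_derive s 1 (fun s => expR (- (c * s))) (- c * expR (- (c * s))).
    by apply: is_derive_eq; rewrite /GRing.scale/=; ring.
  exact: is_derive_continuous.
have ht : h t - h 0 <= 0.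
  suff : h t - h 0 <= (cst 0 : R -> R) t - (cst 0 : R -> R) 0 by rewrite subrr.
  have sub : `[0, t] `<=` `[0, T] by apply: subset_itvl; rewrite bnd_simp.
  apply: (is_derive_le (df := fun s =>
     (dN s - c * (N s + eps ^+ 2)) * expR (- (c * s))) (dg := cst 0)) => //.
  - move=> s /andP[s0 st].
    have sT : 0 < s < T by rewrite s0 (lt_le_trans st).
    have dNs := dN_ s sT.
    by apply: is_derive_eq; rewrite /GRing.scale/=; ring.
  - move=> s /andP[s0 st].
    have sT : 0 < s < T by rewrite s0 (lt_le_trans st).
    by rewrite mulr_le0_ge0 ?expR_ge0// subr_le0 dNle.
  - apply: (continuous_subspaceW sub) => x; apply: cvgM; last exact: cexp.
    by apply: cvgD; [exact: cN|exact: cvg_cst].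
  - by move=> x; exact: cst_continuous.
have Nt : N t <= (N 0 + eps ^+ 2) * expR (c * t).
  move: ht; rewrite subr_le0 /h mulr0 oppr0 expR0 mulr1 expRN ler_pdivrMr ?expR_gt0//.
  by apply: le_trans; rewrite lerDl sqr_ge0.
have S00 : 0 <= \sum_j `|d j 0| by exact: sumr_ge0.
have NS : N 0 <= (\sum_j `|d j 0|) ^+ 2.
  rewrite expr2 mulr_suml; apply: ler_sum => j _.
  rewrite -(real_normK (num_real (d j 0))) expr2 ler_wpM2l//.
  by rewrite (bigD1 j)//= lerDl sumr_ge0.
have ex1 : 1 <= expR (c * t) by rewrite -expR0 ler_expR mulr_ge0.
rewrite -[leRHS]ger0_norm; last by rewrite mulr_ge0 ?expR_ge0// addr_ge0.
rewrite -ler_sqr ?nnegrE// !real_normK ?num_real//.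
apply: le_trans (le_trans _ Nt) _.
  by rewrite /N (bigD1 i)//= lerDl sumr_ge0// => j _; exact: sqr_ge0.
rewrite exprMn mulrC.
apply: ler_pM; rewrite ?expR_ge0 ?addr_ge0 ?sqr_ge0//.
  by rewrite expr2 ler_peMl.
by have := mulr_ge0 S00 e0; nra.
Qed.

Lemma gronwall2 d dd L eps T : 0 <= L -> 0 <= eps ->
  (forall i (t : R), is_derive t 1 (d i) (dd i t)) ->
  (forall i t, `|t| <= T -> `|dd i t| <= L * (\sum_j `|d j t|) + eps) ->
  forall i t, `|t| <= T ->
  `|d i t| <= expR (gronwall_rate L * T) * (\sum_j `|d j 0| + eps).
Proof.
move=> L0 e0 ddd ddL i t tT.
have T0 : 0 <= T by exact: le_trans tT.
have S0 : 0 <= \sum_j `|d j 0| + eps by rewrite addr_ge0// sumr_ge0.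
have c0 : 0 <= gronwall_rate L.
  rewrite /gronwall_rate; have n0 : 0 <= #|I|%:R :> R by rewrite ler0n.
  by have := mulr_ge0 L0 n0; lra.
have le s : 0 <= s <= T ->
    expR (gronwall_rate L * s) * (\sum_j `|d j 0| + eps) <=
    expR (gronwall_rate L * T) * (\sum_j `|d j 0| + eps).
  by move=> /andP[s0 sT]; rewrite ler_wpM2r// ler_expR ler_wpM2l.
case: (leP 0 t) => t0.
  have t0T : 0 <= t <= T by rewrite t0 -(ger0_norm t0).
  apply: le_trans (le t t0T).
  apply: (@gronwall d dd L eps T) => //.
  - by move=> j; exact: is_derive_within_continuous (ddd j).
  - move=> j s /andP[s0 sT]; apply: ddL; rewrite ger0_norm; exact: ltW.
have t0T : 0 <= - t <= T by rewrite oppr_ge0 ltW//= -(ltr0_norm t0).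
apply: le_trans (le _ t0T).
have dn j (s : R) : is_derive s 1 (fun s => d j (- s)) (- dd j (- s)).
  exact: is_derive_comp_opp.
have cn j : {within `[0, T], continuous (fun s => d j (- s))}.
  exact: is_derive_within_continuous (dn j).
have bn j s : 0 < s < T ->
    `|- dd j (- s)| <= L * (\sum_j `|d j (- s)|) + eps.
  move=> /andP[s0 sT]; rewrite normrN; apply: ddL.
  by rewrite normrN ger0_norm ltW.
have := @gronwall (fun j s => d j (- s)) (fun j s => - dd j (- s)) L eps T L0 e0
  (fun j s _ => dn j s) cn bn i (- t) t0T.
by rewrite /= opprK oppr0.
Qed.

End Gronwall.

(** * Existence for the radial equation *)

Section Picard.
Context {R : realType}.

Lemma exists_div_exp2_le (M e : R) : 0 <= M -> 0 < e -> exists n, M / 2 ^+ n <= e.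
Proof.
move=> M0 e0; have h0 : 0 <= M / e by rewrite divr_ge0// ltW.
exists (Num.bound (M / e)).
rewrite ler_pdivrMr ?exprn_gt0// mulrC -ler_pdivrMr//.
apply: le_trans (ltW (archi_boundP h0)) _.
by rewrite -natrX ler_nat ltnW// ltn_expl.
Qed.

Lemma expR_cvg_continuous (f : nat -> R -> R) (g : R -> R) (K mu : R) :
  0 <= K -> 0 <= mu ->
  (forall n, continuous (f n)) ->
  (forall n t, `|g t - f n t| <= K / 2 ^+ n * expR (mu * `|t|)) ->
  continuous g.
Proof.
move=> K0 mu0 cf fg t; apply/cvgrPdist_le => /= e e0.
set M := K * expR (mu * (`|t| + 1)).
have M0 : 0 <= M by rewrite mulr_ge0// expR_ge0.
have [n nM] : exists n, M / 2 ^+ n <= e / 3.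
  by apply: exists_div_exp2_le => //; rewrite divr_gt0.
have near1 : \forall x \near t, `|t - x| < 1.
  by move: (@cvg_id _ (nbhs t)) => /cvgrPdist_lt; apply.
have : \forall x \near t, `|f n t - f n x| <= e / 3.
  by have /cvgrPdist_le := cf n t; apply; rewrite divr_gt0.
have bnd x : `|t - x| < 1 -> `|g x - f n x| <= e / 3.
  move=> tx; apply: le_trans (fg n x) _; apply: le_trans nM.
  rewrite /M mulrAC ler_wpM2r ?invr_ge0 ?exprn_ge0// ler_wpM2l// ler_expR.
  rewrite ler_wpM2l//; have := ler_normD (x - t) t; rewrite subrK distrC; lra.
apply: filterS2 near1 => x tx fx.
have := bnd x tx; have := bnd t; rewrite subrr normr0 => /(_ ltr01).
move: fx; rewrite !ler_norml; lra.
Qed.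

Lemma lipschitz_continuous (g : R -> R) (L : R) : 0 <= L ->
  (forall x y, `|g x - g y| <= L * `|x - y|) -> continuous g.
Proof.
move=> L0 gL x; apply/cvgrPdist_le => e e0.
have : \forall y \near x, `|x - y| <= e / (L + 1).
  by have /cvgrPdist_le := @cvg_id _ (nbhs x); apply; rewrite divr_gt0//; lra.
apply: filterS => y xy; apply: le_trans (gL x y) _.
apply: le_trans (ler_wpM2l L0 xy) _.
by rewrite mulrA ler_pdivrMr; [nra|lra].
Qed.

(** The second-order equation is a fixed-point problem for r alone: r is r0 plus the integral of a
    plus the integral of g(r). The exponential weight avoids any restriction on the length of the
    time interval. *)
Lemma picard (g : R -> R) (L a r0 : R) : 0 <= L ->
  (forall x y, `|g x - g y| <= L * `|x - y|) ->
  exists r s : R -> R, [/\ r 0 = r0, s 0 = a,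
    forall t : R, is_derive t 1 r (s t) & forall t : R, is_derive t 1 s (g (r t))].
Proof.
move=> L0 gL.
have cg : continuous g := lipschitz_continuous L0 gL.
(* [choice] yields a total operator, so a discontinuous f, for which nothing is claimed, also
   receives a value. *)
have /choice[A AP] : forall f : R -> R, exists F : R -> R, continuous f ->
    F 0 = 0 /\ forall t : R, is_derive t 1 F (f t).
  move=> f; have [cf|ncf] := pselect (continuous f); last by exists f.
  by have [F FP] := antiderivative cf; exists F.
pose S (f : R -> R) t := a + A (g \o f) t.
pose P (f : R -> R) t := r0 + A (S f) t.
have cgf (f : R -> R) : continuous f -> continuous (g \o f).
  by move=> cf t; apply: (@cvg_comp _ _ _ f g); [exact: cf|exact: cg].
have Sd f (t : R) : continuous f -> is_derive t 1 (S f) (g (f t)).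
  move=> /cgf/AP[_ /(_ t) d]; rewrite -[g (f t)]add0r.
  by apply: is_deriveD; exact: is_derive_cst.
have cS f : continuous f -> continuous (S f).
  by move=> cf t; exact: is_derive_continuous (Sd f t cf).
have Pd f (t : R) : continuous f -> is_derive t 1 (P f) (S f t).
  move=> /cS/AP[_ /(_ t) d]; rewrite -[S f t]add0r.
  by apply: is_deriveD; exact: is_derive_cst.
have cP f : continuous f -> continuous (P f).
  by move=> cf t; exact: is_derive_continuous (Pd f t cf).
have S0 f : continuous f -> S f 0 = a by move=> /cgf/AP[h _]; rewrite /S h addr0.
have P0 f : continuous f -> P f 0 = r0 by move=> /cS/AP[h _]; rewrite /P h addr0.
pose mu := 2 * L + 1.
have mu0 : 0 < mu by rewrite /mu; lra.
(* [P] contracts by 1/2 in the weighted norm, since [2 L <= mu ^+ 2]. *)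
have contr (f h : R -> R) C : 0 <= C -> continuous f -> continuous h ->
    (forall t, `|f t - h t| <= C * expR (mu * `|t|)) ->
    forall t, `|P f t - P h t| <= C / 2 * expR (mu * `|t|).
  move=> C0 cf ch fh t.
  have dS s : `|S f s - S h s| <= L * C / mu * expR (mu * `|s|).
    apply: (@derive_expR_bound _ (S f - S h) (fun s => g (f s) - g (h s))) => //.
    - by move=> u; apply: is_deriveB; exact: Sd.
    - by rewrite -[(_ - _) 0]/(S f 0 - S h 0) !S0// subrr.
    - by move=> u; apply: le_trans (gL _ _) _; rewrite -mulrA ler_wpM2l.
  have dP : `|P f t - P h t| <= L * C / mu / mu * expR (mu * `|t|).
    apply: (@derive_expR_bound _ (P f - P h) (fun s => S f s - S h s)) => //.
    - by move=> u; apply: is_deriveB; exact: Pd.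
    - by rewrite -[(_ - _) 0]/(P f 0 - P h 0) !P0// subrr.
  apply: le_trans dP _; rewrite ler_wpM2r ?expR_ge0//.
  rewrite !ler_pdivrMr// /mu; nra.
pose rr n := iter n P (cst r0).
have crr n : continuous (rr n).
  by elim: n => [|n IH] /=; [exact: cst_continuous|exact: cP].
have [K K0 K_] : exists2 K, 0 <= K &
    forall t, `|rr 1 t - rr 0 t| <= K * expR (mu * `|t|).
  pose B := `|a| + `|g r0| + 1.
  have B0 : 0 <= B by rewrite /B; have := normr_ge0 a; have := normr_ge0 (g r0); lra.
  have c0 := crr 0.
  have gb t : `|g r0| <= B * expR (mu * `|t|).
    have : 1 <= expR (mu * `|t|) by rewrite -expR0 ler_expR mulr_ge0// ltW.
    by rewrite /B; have := normr_ge0 a; have := normr_ge0 (g r0); nra.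
  have ab t : `|a| <= B * expR (mu * `|t|).
    have : 1 <= expR (mu * `|t|) by rewrite -expR0 ler_expR mulr_ge0// ltW.
    by rewrite /B; have := normr_ge0 a; have := normr_ge0 (g r0); nra.
  have bS t : `|S (rr 0%N) t| <= (B / mu + B) * expR (mu * `|t|).
    rewrite mulrDl addrC; apply: le_trans (ler_normD _ _) _; apply: lerD => //.
    have [h0 hd] := AP _ (cgf _ c0).
    exact: (@derive_expR_bound _ (A (g \o rr 0%N)) (fun s => g r0)).
  exists ((B / mu + B) / mu).
    have m0 := ltW mu0; apply: divr_ge0 => //; apply: addr_ge0 => //.
    exact: divr_ge0.
  move=> t; rewrite /= /P addrAC subrr add0r.
  have [h0 hd] := AP _ (cS _ c0).
  exact: (@derive_expR_bound _ (A (S (rr 0%N))) (fun s => S (rr 0%N) s)).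
have step n t : `|rr n.+1 t - rr n t| <= K / 2 ^+ n * expR (mu * `|t|).
  elim: n t => [|n IH] t; first by rewrite expr0 divr1.
  have h0 : 0 <= K / 2 ^+ n by rewrite divr_ge0// exprn_ge0.
  have := contr _ _ (K / 2 ^+ n) h0 (crr n.+1) (crr n) IH t.
  by rewrite [in K / 2 ^+ n.+1]exprSr invfM mulrA.
(* The difference of two geometric tails is what the induction on m reproduces exactly; the
   subtracted tail is dropped afterwards. *)
have tail n m t : (n <= m)%N ->
    `|rr m t - rr n t| <= (2 * K / 2 ^+ n - 2 * K / 2 ^+ m) * expR (mu * `|t|).
  move=> /subnK <-; elim: (m - n)%N => [|k IH].
    by rewrite add0n !subrr normr0 mul0r.
  rewrite addSn -[rr _ t - rr n t](subrKA (rr (k + n)%N t)).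
  apply: le_trans (ler_normD _ _) _.
  apply: le_trans (lerD (step (k + n)%N t) IH) _.
  rewrite -mulrDl ler_wpM2r ?expR_ge0// exprS invfM.
  by set y := (2 ^+ (k + n))^-1; lra.
have tail_le n m t : (n <= m)%N ->
    `|rr m t - rr n t| <= 2 * K / 2 ^+ n * expR (mu * `|t|).
  move=> nm; apply: le_trans (tail n m t nm) _; rewrite ler_wpM2r ?expR_ge0//.
  by rewrite gerBl divr_ge0 ?exprn_ge0// mulr_ge0.
have cauchy_rr t : cvgn (rr ^~ t).
  apply/cauchy_cvgP/cauchy_exP => e e0 /=.
  have e20 : 0 < e / 2 by rewrite divr_gt0.
  have M0 : 0 <= 2 * K * expR (mu * `|t|) by rewrite !mulr_ge0// expR_ge0.
  have [n nM] := exists_div_exp2_le M0 e20.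
  exists (rr n t); exists n => // m /= nm.
  rewrite /ball/= distrC; apply: le_lt_trans (tail_le n m t nm) _.
  by rewrite mulrAC; apply: le_lt_trans nM _; lra.
pose r t := limn (rr ^~ t).
have rE n t : `|r t - rr n t| <= 2 * K / 2 ^+ n * expR (mu * `|t|).
  have cv : (fun m => `|rr m t - rr n t|) @ \oo --> `|r t - rr n t|.
    by apply: cvg_norm; apply: cvgB; [exact: cauchy_rr|exact: cvg_cst].
  rewrite -(cvg_lim _ cv)//; apply: limr_le; first exact: cvgP cv.
  by exists n => // m /= nm; exact: tail_le.
have K20 : 0 <= 2 * K by rewrite mulr_ge0.
have cr : continuous r := expR_cvg_continuous K20 (ltW mu0) crr rE.
have rP t : P r t = r t.
  apply/eqP; rewrite -subr_eq0 -normr_le0.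
  apply/ler_addgt0Pr => e e0; rewrite add0r.
  have M0 : 0 <= 2 * K * expR (mu * `|t|) by rewrite !mulr_ge0// expR_ge0.
  have [n nM] := exists_div_exp2_le M0 e0.
  have h0 : 0 <= 2 * K / 2 ^+ n by rewrite divr_ge0// exprn_ge0.
  have := contr r (rr n) _ h0 cr (crr n) (rE n) t.
  have := rE n.+1 t; rewrite exprS invfM /=.
  move: nM; rewrite mulrAC; set X := _ / _ * _ => nM.
  rewrite (_ : _ * expR _ = X / 2); last by rewrite /X; field; rewrite expf_neq0.
  rewrite (_ : _ * expR _ = X / 2); last by rewrite /X; field; rewrite expf_neq0.
  move=> h1 h2; apply: le_trans nM.
  rewrite -(subrKA (P (rr n) t)); apply: le_trans (ler_normD _ _) _.
  by move: h1; rewrite distrC; move: h2; lra.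
exists r, (S r); split.
- by rewrite -rP P0.
- exact: S0.
- move=> t; have := Pd r t cr.
  by rewrite (_ : P r = r)//; apply/funext.
- by move=> t; exact: Sd.
Qed.

End Picard.

(** * The radial equation and its energy barrier *)

Section RadialEquation.
Context {R : realType}.
Implicit Types a b c r x t : R.

Lemma derive0_cst (f : R -> R) : (forall t, is_derive t (1 : R) f 0) ->
  forall t, f t = f 0.
Proof.
move=> df t; have cf A := is_derive_within_continuous (A := A) df.
case: (leP 0 t) => t0; first exact: is_derive_zero_cst.
by apply/esym/is_derive_zero_cst => //; exact: ltW.
Qed.

(** Let E = (a^2 + b^2) / 2, the energy at r = 1 with speed a. This X satisfies b^2 X = b^2 + 2 (|c|
    + E + 1), and with ln X <= X the potential at r = 1/X then exceeds E. *)
Definition radius_bound a b c :=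
  1 + 2 * (`|c| + (a ^+ 2 + b ^+ 2) / 2 + 1) / b ^+ 2.

(** This is 1 plus a bound for (r'/r)^2, by |x| <= 1 + x^2. The factor X + X^3 bounds (r + 1/r) /
    r^2 = 1/r + 1/r^3. *)
Definition rate_bound a b c := let X := radius_bound a b c in
  1 + (a ^+ 2 + b ^+ 2) * X ^+ 2 + 2 * `|c| * (X + X ^+ 3).

Lemma norm_ln_le r : 0 < r -> `|ln r| <= r + r^-1.
Proof.
move=> r0; have rV0 : 0 < r^-1 by rewrite invr_gt0.
have := ln_sublinear r0; have := ln_sublinear rV0; rewrite lnV ?posrE// ler_norml.
lra.
Qed.

(* The energy [s^2/2 + b^2/(2 r^2) - c ln r] is conserved and tends to +oo as r -> 0,
   so [r] stays above [(radius_bound a b c)^-1]; hence the vector field may be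
   truncated below that level without changing the solution. *)
Lemma radial_solution a b c : b != 0 ->
  exists r s : R -> R, [/\ r 0 = 1, s 0 = a,
    forall t, is_derive t (1 : R) r (s t),
    forall t, is_derive t (1 : R) s (b ^+ 2 * (r t)^-1 ^+ 3 + c * (r t)^-1)
    & forall t, [/\ 0 < r t, (r t)^-1 <= radius_bound a b c
                & s t ^+ 2 <= a ^+ 2 + b ^+ 2 + 2 * `|c| * (r t + (r t)^-1)]].
Proof.
move=> bn0; set X := radius_bound a b c; pose B := b ^+ 2.
have B0 : 0 < B by rewrite /B exprn_even_gt0.
have c0 := normr_ge0 c; have a20 := sqr_ge0 a.
set E := (a ^+ 2 + B) / 2.
have BX : B * X = B + 2 * (`|c| + E + 1).
  by rewrite /X /radius_bound -/B -/E; field; rewrite gt_eqF.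
have X1 : 1 <= X.
  rewrite /X /radius_bound -/B -/E lerDl divr_ge0 ?(ltW B0)// mulr_ge0// /E; lra.
have X0 : 0 < X by lra.
pose m := X^-1.
have m0 : 0 < m by rewrite invr_gt0.
have m1 : m <= 1 by rewrite /m invf_le1.
pose inv x := (Num.max x m)^-1.
have maxm x : m <= Num.max x m by rewrite le_max lexx orbT.
have max0 x : 0 < Num.max x m by exact: lt_le_trans (maxm x).
have inv0 x : 0 < inv x by rewrite invr_gt0.
have invX x : inv x <= X by rewrite -[X]invrK -/m lef_pV2 ?posrE.
have inv_lip x y : `|inv x - inv y| <= X ^+ 2 * `|x - y|.
  have -> : inv x - inv y = inv x * inv y * (Num.max y m - Num.max x m).
    by rewrite /inv; field; rewrite !gt_eqF.
  rewrite normrM ger0_norm; last by rewrite mulr_ge0// ltW.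
  apply: ler_pM => //; first by rewrite mulr_ge0// ltW.
    by rewrite expr2 ler_pM// ltW.
  rewrite /Num.max; case: ltP => h1; case: ltP => h2;
    by rewrite ler_norml; have := ler_norm (x - y); have := ler_norm (y - x);
       rewrite (distrC y x); lra.
pose g x := B * inv x ^+ 3 + c * inv x.
pose L := (3 * B * X ^+ 2 + `|c|) * X ^+ 2.
have X20 : 0 <= X ^+ 2 by exact: sqr_ge0.
have L0 : 0 <= L by rewrite mulr_ge0// addr_ge0// mulr_ge0//; lra.
have gL x y : `|g x - g y| <= L * `|x - y|.
  have -> : g x - g y = (B * (inv x ^+ 2 + inv x * inv y + inv y ^+ 2) + c) *
      (inv x - inv y) by rewrite /g; ring.
  rewrite normrM /L -mulrA ler_pM//.
  apply: le_trans (ler_normD _ _) _; rewrite lerD2r.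
  rewrite ger0_norm; last first.
    rewrite mulr_ge0 ?(ltW B0)// !addr_ge0 ?sqr_ge0//.
    by rewrite mulr_ge0 ?(ltW (inv0 _)).
  rewrite (_ : 3 * B * _ = B * (X ^+ 2 + X * X + X ^+ 2)); last by ring.
  rewrite ler_wpM2l ?(ltW B0)//.
  have ix := inv0 x; have iy := inv0 y; have iX := invX x; have iY := invX y.
  by rewrite !expr2 !lerD// ler_pM// ltW.
have cg : continuous g := lipschitz_continuous L0 gL.
have [r [s [r0 s0 rs sg]]] := picard a 1 L0 gL.
(* [- G] is the potential of the truncated force; it differs from [V] by a constant on [m, 1]. *)
have [G [G0 dG]] := antiderivative cg.
pose V x := B / 2 * (x^-1) ^+ 2 - c * ln x.
have dV x : 0 < x -> is_derive x 1 V (- (B * (x^-1) ^+ 3 + c * x^-1)).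
  move=> x0; have xn : x != 0 by rewrite gt_eqF.
  have dln := is_derive1_ln x0.
  have dinv := @is_deriveV R id x 1 1 xn (is_derive_id x 1).
  rewrite /V; apply: is_derive_eq; rewrite /GRing.scale/=.
  by field.
have H t : s t ^+ 2 / 2 - G (r t) = a ^+ 2 / 2 - G 1.
  have -> : a ^+ 2 / 2 - G 1 = s 0 ^+ 2 / 2 - G (r 0) by rewrite s0 r0.
  apply: (derive0_cst (f := fun t => s t ^+ 2 / 2 - G (r t))) => u.
  have dr := rs u; have ds := sg u; have dGr := dG (r u).
  have dc := is_derive1_comp dGr dr.
  rewrite -[(fun t => _)]/((fun t => s t ^+ 2 / 2) - (G \o r)).
  have -> : 0 = g (r u) * s u - g (r u) * s u by rewrite subrr.
  apply: is_deriveB.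
  have -> : (fun t => s t ^+ 2 / 2) = (s * s * cst (2^-1)).
    by apply/funext => y; rewrite expr2.
  by apply: is_derive_eq; rewrite /GRing.scale/=; field.
have lnX : `|ln X| <= X.
  rewrite ger0_norm ?ln_ge0//; apply: ltW; exact: ln_sublinear.
have Vm : a ^+ 2 / 2 < V m - V 1.
  rewrite /V /m invrK lnV ?posrE// ln1 invr1.
  have : - (`|c| * X) <= c * ln X.
    rewrite lerNl -mulNr; apply: le_trans (ler_norm _) _.
    by rewrite normrM normrN ler_wpM2l.
  have : 0 <= (X - 1) * (`|c| + E + 1) by rewrite mulr_ge0// /E; lra.
  have : B * X * X = (B + 2 * (`|c| + E + 1)) * X by rewrite BX.
  have : 0 <= B * (X - 1) by rewrite mulr_ge0//; lra.
  rewrite /E; nra.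
(* No first exit time is needed: below [m] the truncated force is still nonnegative, so the
   potential [- G] there is at least [- G m], which already exceeds the conserved energy. *)
have rm t : m < r t.
  rewrite ltNge; apply/negP => rtm.
  have G1 : 0 <= G m - G (r t).
    suff : (cst 0 : R -> R) m - (cst 0 : R -> R) (r t) <= G m - G (r t).
      by rewrite /cst subrr.
    apply: (is_derive_le (df := cst 0) (dg := g)) => //.
    - move=> u /andP[_ um].
      rewrite /cst /g /inv (max_idPr (ltW um)) /m invrK.
      have -> : B * X ^+ 3 + c * X = X * (B * X * X + c) by ring.
      rewrite mulr_ge0 ?(ltW X0)//.
      have BXX : B * X <= B * X * X by rewrite ler_peMr// mulr_ge0// ltW.
      have := ler_norm (- c); rewrite normrN; have E0 : 0 <= E by rewrite /E; lra.
      by move: BXX; rewrite BX; lra.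
    - by move=> x; exact: cst_continuous.
    - exact: is_derive_within_continuous dG.
  have G2 : (G + V) 1 = (G + V) m.
    apply: (is_derive_zero_cst m1).
      move=> u /andP[mu u1]; have u0 := lt_trans m0 mu.
      rewrite -(subrr (g u)); apply: is_deriveD.
      have -> : g u = B * u^-1 ^+ 3 + c * u^-1 by rewrite /g /inv (max_idPl (ltW mu)).
      exact: dV.
    apply: continuous_in_subspaceT => u /[!inE]/= /[!in_itv]/= /andP[mu _].
    apply: cvgD; first exact: (is_derive_continuous (dG u)).
    by apply: (is_derive_continuous (dV u _)); exact: lt_le_trans mu.
  have := H t; move: G2; rewrite -[(G + V) 1]/(G 1 + V 1) -[(G + V) m]/(G m + V m).
  have := sqr_ge0 (s t); lra.
have rt0 t : 0 < r t by exact: lt_trans (rm t).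
have sg' t : is_derive t 1 s (B * (r t)^-1 ^+ 3 + c * (r t)^-1).
  have := sg t; rewrite /g /inv (max_idPl (ltW (rm t))); exact.
exists r, s; split=> // t; split=> //.
  by rewrite -[X]invrK -/m lef_pV2 ?posrE// ltW.
(* Conservation for the untruncated equation; dropping the nonnegative barrier term leaves a bound
   for the speed in terms of ln r. *)
have H2 : s t ^+ 2 / 2 + V (r t) = a ^+ 2 / 2 + V 1.
  have -> : a ^+ 2 / 2 + V 1 = s 0 ^+ 2 / 2 + V (r 0) by rewrite s0 r0.
  apply: (derive0_cst (f := fun t => s t ^+ 2 / 2 + V (r t))) => u.
  have dr := rs u; have ds := sg' u; have dVr := dV (r u) (rt0 u).
  have dc := is_derive1_comp dVr dr.
  rewrite -[(fun t => _)]/((fun t => s t ^+ 2 / 2) + (V \o r)).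
  set gu := B * _ + _ in ds dVr dc *.
  have -> : 0 = gu * s u + (- gu * s u) by rewrite mulNr subrr.
  apply: is_deriveD.
  have -> : (fun t => s t ^+ 2 / 2) = (s * s * cst (2^-1)).
    by apply/funext => y; rewrite expr2.
  by apply: is_derive_eq; rewrite /GRing.scale/=; field.
move: H2; rewrite /V ln1 invr1 expr1n mulr0 subr0 mulr1 -/B.
have : c * ln (r t) <= `|c| * (r t + (r t)^-1).
  apply: le_trans (ler_norm _) _; rewrite normrM ler_wpM2l//.
  exact: norm_ln_le.
have : 0 <= B / 2 * (r t)^-1 ^+ 2 by rewrite mulr_ge0 ?sqr_ge0// divr_ge0// ltW.
lra.
Qed.

(** The bounds are uniform in t because in a^2 = s^2 / r^2 the division by r^2 compensates the
    possible growth of s^2 with r. *)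
Lemma spectral_ode_solution a b c : b != 0 ->
  exists a_ q_ : R -> R, [/\ a_ 0 = a, q_ 0 = 1,
    forall t, is_derive t (1 : R) a_ (- a_ t ^+ 2 + (b * q_ t) ^+ 2 + c * q_ t),
    forall t, is_derive t (1 : R) q_ (- 2 * (a_ t * q_ t))
    & forall t, [/\ `|a_ t| <= rate_bound a b c, 0 <= q_ t
                 & q_ t <= radius_bound a b c ^+ 2]].
Proof.
move=> /(radial_solution a c)[r [s [r0 s0 rs sg bnd]]].
exists (fun t => s t * (r t)^-1), (fun t => (r t)^-1 * (r t)^-1); split.
- by rewrite r0 s0 invr1 mulr1.
- by rewrite r0 invr1 mulr1.
- move=> t; have dr := rs t; have ds := sg t; have [rt0 _ _] := bnd t.
  have rn : r t != 0 by rewrite gt_eqF.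
  have dinv := is_deriveV rn dr.
  by apply: is_derive_eq; rewrite /GRing.scale/=; field.
- move=> t; have dr := rs t; have [rt0 _ _] := bnd t.
  have rn : r t != 0 by rewrite gt_eqF.
  have dinv := is_deriveV rn dr.
  by apply: is_derive_eq; rewrite /GRing.scale/=; field.
- move=> t; have [rt0 rX sb] := bnd t.
  set X := radius_bound a b c in rX *; set i := (r t)^-1 in rX sb *.
  have i0 : 0 < i by rewrite invr_gt0.
  have ri : r t * i = 1 by rewrite /i divff// gt_eqF.
  split; [|by rewrite mulr_ge0// ltW|by rewrite expr2 ler_pM// ltW].
  have c0 := normr_ge0 c.
  have ab0 : 0 <= a ^+ 2 + b ^+ 2 by rewrite addr_ge0// sqr_ge0.
  have q2 : i ^+ 2 <= X ^+ 2 by rewrite !expr2 ler_pM// ltW.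
  have q3 : i ^+ 3 <= X ^+ 3 by rewrite !exprS !expr0 !mulr1 !ler_pM ?mulr_ge0// ltW.
  have : (s t * i) ^+ 2 <= (a ^+ 2 + b ^+ 2) * X ^+ 2 + 2 * `|c| * (X + X ^+ 3).
    rewrite exprMn; apply: le_trans (ler_wpM2r (sqr_ge0 i) sb) _.
    rewrite mulrDl; apply: lerD; first by rewrite ler_wpM2l.
    rewrite -[leLHS]mulrA ler_wpM2l ?mulr_ge0//.
    rewrite (_ : _ * i ^+ 2 = (r t * i) * i + i ^+ 3); last by ring.
    by rewrite ri mul1r lerD.
  rewrite /rate_bound -/X -(real_normK (num_real (s t * i))).
  by have := normr_ge0 (s t * i); nra.
Qed.

End RadialEquation.

(** * Functions of class C^k *)

Lemma near0_line (R : realType) (E : normedModType R) (p v : E) (A : set E) :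
  nbhs p A -> \forall h \near (0 : R)^', A (h *: v + p).
Proof.
move=> pA; have cv : h *: v + p @[h --> (0 : R)] --> p.
  rewrite -[X in _ --> X]add0r -[X in _ --> X + _](scale0r v).
  by apply: cvgD; [apply: cvgZl; exact: cvg_id|exact: cvg_cst].
exact: nbhs_dnbhs (cv _ pA).
Qed.

Section CkWholeSpace.
Context {R : realType} {E : normedModType R}.
Implicit Types (D : set E) (p v : E).

Lemma derivable_inT (W : normedModType R) (f : E -> W) p v :
  derivable_in setT f p v = derivable f p v.
Proof. by rewrite /derivable_in withinET. Qed.

Lemma derive_inT (W : normedModType R) (f : E -> W) v :
  derive_in setT f v = 'D_v f.
Proof. by apply/funext => p; rewrite /derive_in withinET. Qed.

Lemma Ck_continuous (W : normedModType R) n (f : E -> W) :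
  Ck_in n setT f -> continuous f.
Proof. by case: n => [|n] [cf _]; exact/continuous_subspace_setT. Qed.

Lemma CkSP (W : normedModType R) n (f : E -> W) :
  Ck_in n.+1 setT f <->
  continuous f /\ forall v, (forall p, derivable f p v) /\ Ck_in n setT ('D_v f).
Proof.
split=> [[cf df]|[cf df]].
  split; first exact/continuous_subspace_setT.
  move=> v; have [h1 h2] := df v; rewrite derive_inT in h2; split=> // p.
  by rewrite -derivable_inT; exact: h1.
split; first exact: continuous_subspaceT.
move=> v; have [h1 h2] := df v; rewrite derive_inT; split=> // p _.
by rewrite derivable_inT.
Qed.

Lemma Ck0P (W : normedModType R) (f : E -> W) : Ck_in 0 setT f <-> continuous f.
Proof.
split; first exact: Ck_continuous.
by move=> cf; split=> //; exact: continuous_subspaceT.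
Qed.

Lemma CkS_Ck (W : normedModType R) n (f : E -> W) :
  Ck_in n.+1 setT f -> Ck_in n setT f.
Proof.
elim: n f => [|n IH] f /CkSP[cf df]; first exact/Ck0P.
by apply/CkSP; split=> // v; have [h1 h2] := df v; split=> //; exact: IH.
Qed.

Lemma Ck_cst (W : normedModType R) n (w : W) : Ck_in n setT (fun _ : E => w).
Proof.
elim: n w => [|n IH] w; first by apply/Ck0P; exact: cst_continuous.
apply/CkSP; split; first exact: cst_continuous.
move=> v; split; first by move=> p; exact: derivable_cst.
rewrite (_ : 'D_v _ = fun=> 0); first exact: IH.
by apply/funext => p; rewrite -[RHS](derive_cst w p v).
Qed.

Lemma CkD (W : normedModType R) n (f g : E -> W) : Ck_in n setT f ->
  Ck_in n setT g -> Ck_in n setT (fun p => f p + g p).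
Proof.
elim: n f g => [|n IH] f g.
  by move=> /Ck0P cf /Ck0P cg; apply/Ck0P => p; apply: cvgD; [exact: cf|exact: cg].
move=> /CkSP[cf df] /CkSP[cg dg]; apply/CkSP; split.
  by move=> p; apply: cvgD; [exact: cf|exact: cg].
move=> v; have [f1 f2] := df v; have [g1 g2] := dg v; split.
  by move=> p; apply: derivableD.
rewrite (_ : 'D_v _ = fun p => 'D_v f p + 'D_v g p); first exact: IH.
by apply/funext => p; rewrite -deriveD.
Qed.

Lemma CkM n (f g : E -> R) : Ck_in n setT f ->
  Ck_in n setT g -> Ck_in n setT (fun p => f p * g p).
Proof.
elim: n f g => [|n IH] f g.
  by move=> /Ck0P cf /Ck0P cg; apply/Ck0P => p; apply: cvgM; [exact: cf|exact: cg].
move=> Cf Cg; have Cf' := CkS_Ck Cf; have Cg' := CkS_Ck Cg.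
move: Cf Cg => /CkSP[cf df] /CkSP[cg dg]; apply/CkSP; split.
  by move=> p; apply: cvgM; [exact: cf|exact: cg].
move=> v; have [f1 f2] := df v; have [g1 g2] := dg v; split.
  by move=> p; apply: derivableM.
rewrite (_ : 'D_v _ = fun p => f p * 'D_v g p + g p * 'D_v f p).
  by apply: CkD; exact: IH.
by apply/funext => p; rewrite -[LHS]/('D_v (f * g) p) deriveM.
Qed.

Lemma Ck_bigsum (W : normedModType R) n (I : Type) (r : seq I) (f : I -> E -> W) :
  (forall i, Ck_in n setT (f i)) -> Ck_in n setT (fun p => \sum_(i <- r) f i p).
Proof.
move=> Cf; elim: r => [|i r IH].
  by under eq_fun do rewrite big_nil; exact: Ck_cst.
by under eq_fun do rewrite big_cons; exact: CkD.
Qed.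

End CkWholeSpace.

Section CkRestriction.
Context {R : realType} {E W : normedModType R}.
Implicit Types (D : set E) (p v : E) (f g : E -> W).

Lemma Ck_in_eq D n f g : {in D, f =1 g} -> Ck_in n D f -> Ck_in n D g.
Proof.
elim: n f g => [|n IH] f g fg.
  by move=> [cf _]; split=> //; exact: subspace_eq_continuous cf.
move=> [cf df]; split; first exact: subspace_eq_continuous cf.
have E_ v p : D p -> (h^-1 *: (f (h *: v + p) - f p)
      @[h --> within [set h | D (h *: v + p)] 0^']) =
    (h^-1 *: (g (h *: v + p) - g p) @[h --> within [set h | D (h *: v + p)] 0^']).
  move=> Dp; apply/seteqP.
  split; apply: near_eq_cvg; apply: (@filterE _ 0^') => h /= Dh;
    by rewrite !fg// inE.
move=> v; have [h1 h2] := df v; split.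
  by move=> p Dp; rewrite /derivable_in -E_//; exact: h1.
apply: IH h2 => p /[!inE] Dp; rewrite /derive_in E_//.
Qed.

(** In every direction, nonzero increments of arbitrarily small size stay in [D]. Limits within [D]
    are then unique, so a restricted derivative must equal the unrestricted one whenever the latter
    exists. *)
Definition accessible D := forall p v, D p ->
  ProperFilter (within [set h | D (h *: v + p)] (0 : R)^').

Lemma derive_in_restrict D f p v : accessible D -> D p -> derivable f p v ->
  derivable_in D f p v /\ derive_in D f v p = 'D_v f p.
Proof.
move=> aD Dp fd; have pf := aD p v Dp.
have cv : (h^-1 *: (f (h *: v + p) - f p)
    @[h --> within [set h | D (h *: v + p)] 0^']) --> 'D_v f p.
  exact: cvg_within_filter.
by split; [exact: cvgP cv|exact: cvg_lim].
Qed.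

Lemma Ck_restrict D n f : accessible D -> Ck_in n setT f -> Ck_in n D f.
Proof.
move=> aD; elim: n f => [|n IH] f.
  by move=> /Ck0P cf; split=> //; exact: continuous_subspaceT.
move=> /CkSP[cf df]; split; first exact: continuous_subspaceT.
move=> v; have [h1 h2] := df v; split.
  by move=> p Dp; have [] := derive_in_restrict aD Dp (h1 p).
apply: Ck_in_eq (IH _ h2) => p /[!inE] Dp.
by have [_ ->] := derive_in_restrict aD Dp (h1 p).
Qed.

End CkRestriction.

Lemma accessible_slab (R : realType) : accessible (@slab R `[0, +oo[).
Proof.
move=> p v; rewrite /slab/= in_itv/= andbT => p0.
apply: Build_ProperFilter_ex => A [e /= e0 eA].
(* The sign of [h] follows that of [v.1], so the time coordinate never decreases; this matters at t
   = 0. *)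
pose h := if 0 <= v.1 then e / 2 else - (e / 2).
exists h; apply: eA => /=.
- rewrite sub0r normrN /h; case: ifP => _; rewrite ?normrN gtr0_norm; lra.
- by rewrite /h; case: ifP => _; rewrite ?oppr_eq0 gt_eqF//; lra.
- rewrite /slab/= in_itv/= andbT addr_ge0// /GRing.scale/= /h.
  case: ifPn => [v0|]; first by rewrite mulr_ge0//; lra.
  by rewrite -ltNge => v0; nra.
Qed.

(** * Quadratic systems and their dependence on initial data *)

Section MeanValue.
Context {R : realType}.
Implicit Types (f : R -> R).

Lemma mean_value_approx f (df : R -> R) (a b l e : R) :
  (forall t, `|t - a| <= `|b - a| -> is_derive t 1 f (df t)) ->
  (forall t, `|t - a| <= `|b - a| -> `|df t - l| <= e) ->
  `|f b - f a - (b - a) * l| <= e * `|b - a|.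
Proof.
move=> fdf dfe.
pose g := f - (fun t => t * l).
have gE t : g t = f t - t * l by [].
have gdg t : `|t - a| <= `|b - a| -> is_derive t 1 g (df t - l).
  move=> /fdf d; apply: is_deriveB.
  by apply: is_derive_eq; rewrite /GRing.scale/=; ring.
have ede (t : R) : is_derive t 1 (fun t => t * e) e.
  by apply: is_derive_eq; rewrite /GRing.scale/=; ring.
have -> : f b - f a - (b - a) * l = g b - g a by rewrite !gE; ring.
have [ab|ba] := leP a b.
  have sub t : a <= t <= b -> `|t - a| <= `|b - a|.
    by move=> /andP[h1 h2]; rewrite !ger0_norm ?subr_ge0// lerD2r.
  rewrite [`|b - a|]ger0_norm ?subr_ge0// mulrBr ![e * _]mulrC.
  apply: (is_derive_norm_le (g := fun t => t * e)
    (df := fun t => df t - l) (dg := cst e)) => //.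
  - by move=> t /andP[h1 h2]; apply: gdg; rewrite sub// !ltW.
  - by move=> t /andP[h1 h2]; apply: dfe; rewrite sub// !ltW.
  - apply: continuous_in_subspaceT => t /[!inE]/= /[!in_itv]/= tab.
    exact: is_derive_continuous (gdg t (sub t tab)).
  - exact: is_derive_within_continuous ede.
have sub t : b <= t <= a -> `|t - a| <= `|b - a|.
  move=> /andP[h1 h2]; rewrite !ler0_norm ?subr_le0//; last exact: ltW.
  by rewrite lerN2 lerD2r.
have -> : `|b - a| = a - b by rewrite distrC ger0_norm// subr_ge0 ltW.
rewrite mulrBr ![e * _]mulrC.
rewrite distrC.
apply: (is_derive_norm_le (g := fun t => t * e)
  (df := fun t => df t - l) (dg := cst e)) => //; first exact: ltW.
- by move=> t /andP[h1 h2]; apply: gdg; rewrite sub// !ltW.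
- by move=> t /andP[h1 h2]; apply: dfe; rewrite sub// !ltW.
- apply: continuous_in_subspaceT => t /[!inE]/= /[!in_itv]/= tab.
  exact: is_derive_continuous (gdg t (sub t tab)).
- exact: is_derive_within_continuous ede.
Qed.

Lemma is_derive_epsP f (l t : R) :
  (forall e, 0 < e -> \forall s \near t, `|f s - f t - (s - t) * l| <= e * `|s - t|) ->
  is_derive t 1 f l.
Proof.
move=> fl.
suff cv : h^-1 *: ((f \o shift t) (h *: 1) - f t) @[h --> 0^'] --> l.
  by apply: DeriveDef; [exact: cvgP cv|exact: cvg_lim].
apply/cvgrPdist_le => e e0; have [d /= d0 dP] := fl e e0.
exists d => //= h /=; rewrite sub0r normrN => hd hn0.
rewrite /GRing.scale/= mulr1.
have -> : l - h^-1 * (f (h + t) - f t) = - (h^-1 * (f (h + t) - f t - (h + t - t) * l)).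
  by field.
rewrite normrN normrM normfV ler_pdivrMl ?normr_gt0// [leRHS]mulrC.
have := dP (h + t); rewrite /ball_/= opprD addrCA subrr addr0 normrN => /(_ hd).
by rewrite !addrK.
Qed.

(** The mean value estimate holds for all [f h] with the same error, and a non-strict inequality
    survives the limit along [F]. *)
Lemma is_derive_uniform_limit (H : Type) (F : set_system H) (FF : ProperFilter F)
    (f g : H -> R -> R) (f0 g0 : R -> R) (T : R) :
  (\forall h \near F, forall t : R, is_derive t 1 (f h) (g h t)) ->
  (\forall h \near F, continuous (g h)) ->
  (forall e, 0 < e -> \forall h \near F, forall t, `|t| <= T -> `|g h t - g0 t| <= e) ->
  (forall t, `|t| <= T -> f h t @[h --> F] --> f0 t) ->
  forall t : R, `|t| < T -> is_derive t 1 f0 (g0 t).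
Proof.
move=> fdg cg gu fl t tT; apply: is_derive_epsP => e e0.
have e4 : 0 < e / 4 by rewrite divr_gt0.
(* A single member [g h0] lends its continuity at t to the limit; the deviation of [g h u] from
   [g0 t] splits into four errors of size e / 4. *)
have [h0 [cgh0 guh0]] := filter_ex (filterI cg (gu _ e4)).
have n1 : \forall s \near t, `|g h0 t - g h0 s| <= e / 4.
  by have /cvgrPdist_le := cgh0 t; apply.
have n2 : \forall s \near t, `|t - s| <= T - `|t|.
  by have /cvgrPdist_le := @cvg_id _ (nbhs t); apply; rewrite subr_gt0.
have [d /= d0 dP] := filterI n1 n2.
exists d => //= s ts.
have sT u : `|u - t| <= `|s - t| -> `|u| <= T /\ `|g h0 t - g h0 u| <= e / 4.
  move=> us; have [|h1 h2] := dP u.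
    by rewrite /ball_/= distrC; apply: le_lt_trans us _; rewrite distrC.
  split=> //; have := ler_normD (u - t) t; rewrite subrK (distrC u t); lra.
have bd : \forall h \near F, `|f h s - f h t - (s - t) * g0 t| <= e * `|s - t|.
  apply: filterS2 (gu _ e4) fdg => h gh dfh.
  apply: (@mean_value_approx _ (g h)) => // u us.
  have [uT h1] := sT u us.
  have [tT' _] : `|t| <= T /\ `|g h0 t - g h0 t| <= e / 4.
    by apply: sT; rewrite subrr normr0.
  have h2 := gh u uT; have h3 := guh0 u uT; have h4 := guh0 t tT'.
  have -> : g h u - g0 t = (g h u - g0 u) - (g h0 u - g0 u)
      - (g h0 t - g h0 u) + (g h0 t - g0 t) by lra.
  apply: le_trans (ler_normD _ _) _; rewrite (_ : e = e / 4 + e / 4 + e / 4 + e / 4); last lra.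
  rewrite lerD//; apply: le_trans (ler_normB _ _) _; rewrite lerD//.
  by apply: le_trans (ler_normB _ _) _; rewrite lerD.
have sT' : `|s| <= T by have [] := sT s (lexx _).
have cv : `|f h s - f h t - (s - t) * g0 t| @[h --> F] --> `|f0 s - f0 t - (s - t) * g0 t|.
  apply: cvg_norm; apply: cvgB; last exact: cvg_cst.
  by apply: cvgB; apply: fl => //; exact: ltW.
rewrite -(cvg_lim _ cv)//; apply: limr_le; first exact: cvgP cv.
exact: bd.
Qed.

End MeanValue.

Section QuadraticForms.
Context {R : realType} {I : finType}.
(* [(c, j, k) \in tm i] stands for the monomial [c * y_j * y_k] in the
   equation of [y_i]. *)
Implicit Types (tm : I -> seq (R * I * I)) (y z : I -> R).

Definition quad tm y z i := \sum_(m <- tm i) m.1.1 * (y m.1.2 * z m.2).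

Definition quad_norm tm : R := \sum_i \sum_(m <- tm i) `|m.1.1|.

Lemma quad_norm_ge0 tm : 0 <= quad_norm tm.
Proof. by apply: sumr_ge0 => i _; exact: sumr_ge0. Qed.

Lemma quad_lel tm y z i K : (forall j, `|y j| <= K) ->
  `|quad tm y z i| <= quad_norm tm * K * \sum_j `|z j|.
Proof.
move=> yK.
have K0 : 0 <= K by exact: le_trans (yK i).
set S := \sum_j `|z j|; have S0 : 0 <= S by exact: sumr_ge0.
apply: le_trans (ler_norm_sum _ _ _) _.
apply: (@le_trans _ _ (\sum_(m <- tm i) `|m.1.1| * (K * S))).
  apply: ler_sum => m _; rewrite normrM ler_wpM2l// normrM ler_pM//.
  by rewrite /S (bigD1 m.2)//= lerDl sumr_ge0.
rewrite -mulr_suml -mulrA ler_wpM2r ?mulr_ge0//.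
rewrite /quad_norm (bigD1 i)//= lerDl sumr_ge0// => j _; exact: sumr_ge0.
Qed.

Lemma quad_ler tm y z i K : (forall j, `|z j| <= K) ->
  `|quad tm y z i| <= quad_norm tm * K * \sum_j `|y j|.
Proof.
move=> zK.
have K0 : 0 <= K by exact: le_trans (zK i).
set S := \sum_j `|y j|; have S0 : 0 <= S by exact: sumr_ge0.
apply: le_trans (ler_norm_sum _ _ _) _.
apply: (@le_trans _ _ (\sum_(m <- tm i) `|m.1.1| * (K * S))).
  apply: ler_sum => m _; rewrite normrM ler_wpM2l// normrM mulrC ler_pM//.
  by rewrite /S (bigD1 m.1.2)//= lerDl sumr_ge0.
rewrite -mulr_suml -mulrA ler_wpM2r ?mulr_ge0//.
rewrite /quad_norm (bigD1 i)//= lerDl sumr_ge0// => j _; exact: sumr_ge0.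
Qed.

(** This exact polarisation is behind both the comparison of two solutions and the linear equation
    of the difference quotients. *)
Lemma quadB tm y y' i : quad tm y y i - quad tm y' y' i =
  quad tm y (fun j => y j - y' j) i + quad tm (fun j => y j - y' j) y' i.
Proof.
by rewrite /quad -sumrB -big_split; apply: eq_bigr => m _; rewrite /=; ring.
Qed.

Lemma quadZ tm y z i k : k * quad tm y z i = quad tm (fun j => k * y j) z i.
Proof. by rewrite /quad mulr_sumr; apply: eq_bigr => m _; ring. Qed.

Lemma quadZr tm y z i k : k * quad tm y z i = quad tm y (fun j => k * z j) i.
Proof. by rewrite /quad mulr_sumr; apply: eq_bigr => m _; ring. Qed.

Lemma quadBl tm y y' z i :
  quad tm (fun j => y j - y' j) z i = quad tm y z i - quad tm y' z i.
Proof. by rewrite /quad -sumrB; apply: eq_bigr => m _; ring. Qed.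

Lemma quadBr tm y z z' i :
  quad tm y (fun j => z j - z' j) i = quad tm y z i - quad tm y z' i.
Proof. by rewrite /quad -sumrB; apply: eq_bigr => m _; ring. Qed.

Lemma cvg_quad (T : Type) (F : set_system T) (FF : Filter F) tm
    (y z : I -> T -> R) (y0 z0 : I -> R) i :
  (forall j, y j x @[x --> F] --> y0 j) -> (forall j, z j x @[x --> F] --> z0 j) ->
  quad tm (y ^~ x) (z ^~ x) i @[x --> F] --> quad tm y0 z0 i.
Proof.
move=> cy cz; apply: cvg_bigsum => m.
by apply: cvgM; [exact: cvg_cst|exact: cvgM].
Qed.

End QuadraticForms.

Section QuadraticSystem.
Context {R : realType} {I : finType}.
Variable tm : I -> seq (R * I * I).
Implicit Types (y z : I -> R -> R).

Definition quad_solution y := forall i (t : R),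
  is_derive t 1 (y i) (quad tm (y ^~ t) (y ^~ t) i).

Definition flow_const (K T : R) : R :=
  expR (@gronwall_rate R I (2 * quad_norm tm * K) * T).

Lemma flow_const_ge0 K T : 0 <= flow_const K T.
Proof. exact: expR_ge0. Qed.

Lemma quad_solution_lipschitz y y' K T : 0 <= K ->
  quad_solution y -> quad_solution y' ->
  (forall i t, `|t| <= T -> `|y i t| <= K) ->
  (forall i t, `|t| <= T -> `|y' i t| <= K) ->
  forall i t, `|t| <= T ->
  `|y i t - y' i t| <= flow_const K T * \sum_j `|y j 0 - y' j 0|.
Proof.
move=> K0 sy sy' yK yK' i t tT.
have := @gronwall2 R I (fun j => y j - y' j)
  (fun j s => quad tm (y ^~ s) (y ^~ s) j - quad tm (y' ^~ s) (y' ^~ s) j)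
  (2 * quad_norm tm * K) 0 T _ (lexx 0) _ _ i t tT.
rewrite addr0; apply.
- by rewrite !mulr_ge0// quad_norm_ge0.
- by move=> j s; apply: is_deriveB; [exact: sy|exact: sy'].
- move=> j s sT; rewrite addr0 quadB; apply: le_trans (ler_normD _ _) _.
  have := quad_lel tm (fun j => y j s - y' j s) j (fun k => yK k s sT).
  have := quad_ler tm (fun j => y j s - y' j s) j (fun k => yK' k s sT).
  rewrite -[\sum_j0 `|(y j0 - y' j0) s|]/(\sum_j0 `|y j0 s - y' j0 s|); lra.
Qed.

(* [z] solves the equation of the difference quotients, linearised between the
   solutions [u] and [w]. *)
Definition quad_linearized u w z := forall i (t : R),
  is_derive t 1 (z i) (quad tm (u ^~ t) (z ^~ t) i + quad tm (z ^~ t) (w ^~ t) i).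

Lemma quad_linearized_bound u w z K T : 0 <= K -> quad_linearized u w z ->
  (forall i t, `|t| <= T -> `|u i t| <= K) ->
  (forall i t, `|t| <= T -> `|w i t| <= K) ->
  forall i t, `|t| <= T -> `|z i t| <= flow_const K T * \sum_j `|z j 0|.
Proof.
move=> K0 lz uK wK i t tT.
have := @gronwall2 R I z
  (fun j s => quad tm (u ^~ s) (z ^~ s) j + quad tm (z ^~ s) (w ^~ s) j)
  (2 * quad_norm tm * K) 0 T _ (lexx 0) lz _ i t tT.
rewrite addr0; apply; first by rewrite !mulr_ge0// quad_norm_ge0.
move=> j s sT; rewrite addr0; apply: le_trans (ler_normD _ _) _.
have := quad_lel tm (z ^~ s) j (fun k => uK k s sT).
have := quad_ler tm (z ^~ s) j (fun k => wK k s sT).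
lra.
Qed.

(** As both equations share [w], the difference z - z' solves the linearised equation with the
    single forcing term [quad tm (u - u') z'], which [M] and [eta] control. *)
Lemma quad_linearized_compare u u' w z z' K M eta T : 0 <= K -> 0 <= M ->
  0 <= eta ->
  quad_linearized u w z -> quad_linearized u' w z' ->
  (forall i t, `|t| <= T -> `|u i t| <= K) ->
  (forall i t, `|t| <= T -> `|w i t| <= K) ->
  (forall i t, `|t| <= T -> `|z' i t| <= M) ->
  (forall i t, `|t| <= T -> `|u i t - u' i t| <= eta) ->
  forall i t, `|t| <= T -> `|z i t - z' i t| <=
    flow_const K T * (\sum_j `|z j 0 - z' j 0| + quad_norm tm * M * (#|I|%:R * eta)).
Proof.
move=> K0 M0 eta0 lz lz' uK wK zM ueta i t tT.
have := @gronwall2 R I (fun j => z j - z' j)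
  (fun j s => quad tm (u ^~ s) (z ^~ s) j + quad tm (z ^~ s) (w ^~ s) j -
     (quad tm (u' ^~ s) (z' ^~ s) j + quad tm (z' ^~ s) (w ^~ s) j))
  (2 * quad_norm tm * K) (quad_norm tm * M * (#|I|%:R * eta)) T _ _ _ _ i t tT.
apply.
- by rewrite !mulr_ge0// quad_norm_ge0.
- by rewrite !mulr_ge0// quad_norm_ge0.
- by move=> j s; apply: is_deriveB; [exact: lz|exact: lz'].
- move=> j s sT.
  have -> : quad tm (u ^~ s) (z ^~ s) j + quad tm (z ^~ s) (w ^~ s) j -
     (quad tm (u' ^~ s) (z' ^~ s) j + quad tm (z' ^~ s) (w ^~ s) j) =
     quad tm (u ^~ s) (fun k => z k s - z' k s) j +
     quad tm (fun k => z k s - z' k s) (w ^~ s) j +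
     quad tm (fun k => u k s - u' k s) (z' ^~ s) j.
    by rewrite quadBr !quadBl; ring.
  apply: le_trans (ler_normD _ _) _; apply: lerD.
    apply: le_trans (ler_normD _ _) _.
    have := quad_lel tm (fun k => z k s - z' k s) j (fun k => uK k s sT).
    have := quad_ler tm (fun k => z k s - z' k s) j (fun k => wK k s sT).
    rewrite -[\sum_j0 `|(z j0 - z' j0) s|]/(\sum_j0 `|z j0 s - z' j0 s|); lra.
  have := quad_ler tm (fun k => u k s - u' k s) j (fun k => zM k s sT).
  move=> /le_trans; apply; rewrite ler_wpM2l// ?mulr_ge0 ?quad_norm_ge0//.
  apply: (@le_trans _ _ (\sum_(k : I) eta)).
    by apply: ler_sum => k _; exact: ueta.
  by rewrite sumr_const mulr_natl.
Qed.

End QuadraticSystem.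

(** * Differentiability of the flow in the label *)

Section Flow.
Context {R : realType} {P : normedModType R} {I : finType}.
Variable tm : I -> seq (R * I * I).
Variable y : I -> R * P -> R.
Implicit Types (p v : P) (t T h : R).

Definition flow_solution := forall p, quad_solution tm (fun i t => y i (t, p)).

(** Uniformity over nearby labels lets one Gronwall constant serve all the solutions that enter a
    difference quotient. *)
Definition locally_bounded := forall p T, exists2 K, 0 <= K &
  \forall p' \near p, forall i t, `|t| <= T -> `|y i (t, p')| <= K.

Hypothesis sol : flow_solution.
Hypothesis lb : locally_bounded.

Lemma flow_initial_cvg0 p (C : R) : (forall i, continuous (fun q => y i (0, q))) ->
  C * (\sum_j `|y j (0, q) - y j (0, p)|) @[q --> p] --> 0.
Proof.
move=> cy; rewrite -[X in _ --> X](mulr0 C); apply: cvgM; first exact: cvg_cst.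
apply: cvg_bigsum0 => j.
rewrite [X in _ --> X](_ : 0 = `|y j (0, p) - y j (0, p)|); last by rewrite subrr normr0.
by apply: cvg_norm; apply: cvgB; [exact: cy|exact: cvg_cst].
Qed.

Lemma flow_continuous : (forall i, continuous (fun q => y i (0, q))) ->
  forall i, continuous (y i).
Proof.
move=> cy i [t p]; apply/cvgrPdist_le => e e0.
have [K K0 pK] := lb p (`|t| + 1).
have e2 : 0 < e / 2 by rewrite divr_gt0.
have n0 := flow_initial_cvg0 p (flow_const tm K (`|t| + 1)) cy.
have {}n0 : \forall q \near p,
    `|0 - flow_const tm K (`|t| + 1) * (\sum_j `|y j (0, q) - y j (0, p)|)| <= e / 2.
  by move/cvgrPdist_le : n0; apply.
have n1 : \forall s \near t, `|t - s| <= 1.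
  by have /cvgrPdist_le := @cvg_id _ (nbhs t); apply.
have n2 : \forall s \near t, `|y i (t, p) - y i (s, p)| <= e / 2.
  have /cvgrPdist_le := is_derive_continuous (sol p i t); exact.
exists ([set s | `|t - s| <= 1 /\ `|y i (t, p) - y i (s, p)| <= e / 2],
   [set q | `|0 - flow_const tm K (`|t| + 1) *
     (\sum_j `|y j (0, q) - y j (0, p)|)| <= e / 2 /\
     forall i t', `|t'| <= `|t| + 1 -> `|y i (t', q)| <= K]).
  by split; apply: filterI.
move=> [s q] [/= [ts ys] [yq qK]].
have sT : `|s| <= `|t| + 1.
  have := ler_normD (s - t) t; rewrite subrK (distrC s t); lra.
(* The label is changed at the fixed time s, by the Lipschitz estimate, and the time at the fixed
   label p, by continuity of one trajectory. *)
have := quad_solution_lipschitz K0 (sol q) (sol p) qK (nbhs_singleton pK) i sT.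
rewrite distrC => h; rewrite -(subrKA (y i (s, p))) (_ : e = e / 2 + e / 2); last lra.
apply: le_trans (ler_normD _ _) _; apply: lerD => //; apply: le_trans h _.
by move: yq; rewrite sub0r normrN; apply: le_trans; exact: ler_norm.
Qed.

Definition quotient p v h i t : R := h^-1 * (y i (t, h *: v + p) - y i (t, p)).

Lemma quotient_linearized p v h :
  quad_linearized tm (fun i t => y i (t, h *: v + p)) (fun i t => y i (t, p))
    (quotient p v h).
Proof.
move=> i t; have d1 := sol (h *: v + p) i t; have d2 := sol p i t.
have -> : quotient p v h i =
    h^-1 *: ((fun t => y i (t, h *: v + p)) - (fun t => y i (t, p))) by [].
apply: is_derive_eq.
by rewrite quadB scalerDr /GRing.scale/= quadZr quadZ.
Qed.

Hypothesis cy0 : forall i, continuous (fun q => y i (0, q)).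

(** The limit is not yet known to exist, so quotients are compared with one another. Their initial
    values differ by at most [e h + e h'], their coefficients by a multiple of [eta h + eta h']. The
    modulus depends neither on i nor on t, so the convergence is uniform on the time interval. *)
Lemma quotient_cauchy p v T : (forall i, derivable (fun q => y i (0, q)) p v) ->
  exists (G : set R) (w : R -> R), [/\ (0 : R)^' G, w h @[h --> (0 : R)^'] --> 0 &
    forall h h', G h -> G h' -> forall i t, `|t| <= T ->
    `|quotient p v h i t - quotient p v h' i t| <= w h + w h'].
Proof.
move=> dy; have [K K0 pK] := lb p T.
pose D0 i := 'D_v (fun q => y i (0, q)) p.
have cq i : quotient p v h i 0 @[h --> (0 : R)^'] --> D0 i by exact: dy.
pose e h : R := \sum_j `|quotient p v h j 0 - D0 j|.
pose eta h : R := \sum_j `|y j (0, h *: v + p) - y j (0, p)|.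
have ce : e h @[h --> (0 : R)^'] --> 0.
  apply: cvg_bigsum0 => j.
  rewrite [X in _ --> X](_ : 0 = `|D0 j - D0 j|); last by rewrite subrr normr0.
  by apply: cvg_norm; apply: cvgB; [exact: cq|exact: cvg_cst].
have ceta : eta h @[h --> (0 : R)^'] --> 0.
  have := flow_initial_cvg0 p 1 cy0; under eq_fun do rewrite mul1r.
  by move=> + A A0 => /(_ A A0)/(near0_line v).
set C := flow_const tm K T.
have C0 : 0 <= C := flow_const_ge0 tm K T.
(* For h in the set below the initial quotients are within 1 of the derivatives [D0], in sum, so [M]
   bounds the quotients on the whole time interval. *)
set M := C * (\sum_j `|D0 j| + 1).
have S0 : 0 <= \sum_j `|D0 j| by exact: sumr_ge0.
have M0 : 0 <= M by rewrite mulr_ge0// addr_ge0.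
pose C2 := C * (quad_norm tm * M * (#|I|%:R * C)).
exists [set h | (forall i t, `|t| <= T -> `|y i (t, h *: v + p)| <= K) /\ e h <= 1].
exists (fun h => C * e h + C2 * eta h); split.
- apply: filterI; first exact: near0_line pK.
  move/cvgrPdist_le : ce => /(_ 1 ltr01); apply: filterS => h.
  by rewrite sub0r normrN; apply: le_trans; exact: ler_norm.
- rewrite -[X in _ --> X](_ : C * 0 + C2 * 0 = 0); last by rewrite !mulr0 addr0.
  by apply: cvgD; apply: cvgM => //; exact: cvg_cst.
- move=> h h' [hK he] [hK' he'] i t tT.
  have pK' := nbhs_singleton pK.
  have zM j s : `|s| <= T -> `|quotient p v h' j s| <= M.
    move=> sT.
    have := quad_linearized_bound K0 (quotient_linearized p v h') hK' pK' j sT.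
    move=> /le_trans; apply; rewrite ler_wpM2l//.
    apply: le_trans (lerD (lexx _) he'); rewrite /e -big_split/=.
    apply: ler_sum => k _; have := ler_normD (D0 k) (quotient p v h' k 0 - D0 k).
    by rewrite addrCA subrr addr0.
  have eta0 h0 : 0 <= eta h0 by exact: sumr_ge0.
  have ueta j s : `|s| <= T -> `|y j (s, h *: v + p) - y j (s, h' *: v + p)| <=
      C * (eta h + eta h').
    move=> sT.
    have := quad_solution_lipschitz K0 (sol (h *: v + p)) (sol (h' *: v + p)) hK hK' j sT.
    move=> /le_trans; apply; rewrite ler_wpM2l// /eta -big_split/=.
    apply: ler_sum => k _; rewrite [X in _ <= _ + X]distrC.
    rewrite -(subrKA (y k (0, p))); exact: ler_normD.
  have e0 : 0 <= C * (eta h + eta h') by rewrite mulr_ge0// addr_ge0.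
  have := quad_linearized_compare K0 M0 e0 (quotient_linearized p v h)
    (quotient_linearized p v h') hK pK' zM ueta i tT.
  move=> /le_trans; apply; rewrite -/C.
  have : \sum_j `|quotient p v h j 0 - quotient p v h' j 0| <= e h + e h'.
    rewrite /e -big_split/=; apply: ler_sum => k _; rewrite [X in _ <= _ + X]distrC.
    rewrite -(subrKA (D0 k)); exact: ler_normD.
  move=> /(ler_wpM2l C0); rewrite /C2; lra.
Qed.

Definition flow_derive v i (q : R * P) := 'D_v (fun p => y i (q.1, p)) q.2.

Lemma flow_derivable p v : (forall i, derivable (fun q => y i (0, q)) p v) ->
  forall i t, derivable (fun q => y i (t, q)) p v.
Proof.
move=> dy i t; have [G [w [nG cw GP]]] := quotient_cauchy `|t| dy.
apply/cauchy_cvgP/cauchy_exP => e e0 /=.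
have e2 : 0 < e / 2 by rewrite divr_gt0.
have nw : \forall h \near (0 : R)^', w h < e / 2.
  move/cvgrPdist_lt : cw => /(_ _ e2); apply: filterS => h.
  by rewrite sub0r normrN; apply: le_lt_trans; exact: ler_norm.
have nGw : \forall h \near (0 : R)^', G h /\ w h < e / 2 by exact: filterI.
have [h0 [Gh0 wh0]] := @filter_ex _ _ (Proper_dnbhs_numFieldType (0 : R)) _ nGw.
exists (quotient p v h0 i t).
apply: filterS nGw => h [Gh wh]; rewrite /ball/=.
apply: le_lt_trans (GP h0 h Gh0 Gh i t (lexx _)) _; lra.
Qed.

Lemma quotient_uniform_cvg p v T : (forall i, derivable (fun q => y i (0, q)) p v) ->
  forall e, 0 < e -> \forall h \near (0 : R)^', forall i t, `|t| <= T ->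
  `|quotient p v h i t - flow_derive v i (t, p)| <= e.
Proof.
move=> dy e e0; have [G [w [nG cw GP]]] := quotient_cauchy T dy.
have e2 : 0 < e / 2 by rewrite divr_gt0.
have nw : \forall h \near (0 : R)^', w h <= e / 2.
  move/cvgrPdist_lt : cw => /(_ _ e2); apply: filterS => h.
  by rewrite sub0r normrN => /ltW; apply: le_trans; exact: ler_norm.
have nGw : \forall h \near (0 : R)^', G h /\ w h <= e / 2 by exact: filterI.
apply: (filterS _ nGw) => h [Gh wh] i t tT.
have cv : `|quotient p v h i t - quotient p v h' i t| @[h' --> (0 : R)^'] -->
    `|quotient p v h i t - flow_derive v i (t, p)|.
  apply: cvg_norm; apply: cvgB; first exact: cvg_cst.
  exact: flow_derivable.
rewrite -(cvg_lim _ cv)//; apply: limr_le; first exact: cvgP cv.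
apply: filterS nGw => h' [Gh' wh'].
apply: le_trans (GP h h' Gh Gh' i t tT) _; lra.
Qed.

(** The variational equation: the equations of the quotients pass to the limit because both the
    quotients and their time derivatives converge uniformly. *)
Lemma flow_derive_linearized p v : (forall i, derivable (fun q => y i (0, q)) p v) ->
  quad_linearized tm (fun i t => y i (t, p)) (fun i t => y i (t, p))
    (fun i t => flow_derive v i (t, p)).
Proof.
move=> dy i t0; pose T := `|t0| + 1.
have t0T : `|t0| < T by rewrite ltrDl.
have [K K0 pK] := lb p T.
have pK' := nbhs_singleton pK.
set z := flow_derive v.
set C := flow_const tm K T.
have C0 : 0 <= C := flow_const_ge0 tm K T.
have nK := near0_line v pK.
(* The limit is bounded through one quotient at distance at most 1 from it. *)
have [M M0 zM] : exists2 M, 0 <= M & forall j t, `|t| <= T -> `|z j (t, p)| <= M.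
  have [h [hK hu]] := filter_ex (filterI nK (quotient_uniform_cvg T dy (ltr01 : 0 < (1 : R)))).
  exists (C * (\sum_j `|quotient p v h j 0|) + 1).
    by rewrite addr_ge0// mulr_ge0// sumr_ge0.
  move=> j t tT; have h1 := hu j t tT.
  have h2 := quad_linearized_bound K0 (quotient_linearized p v h) hK pK' j tT.
  have := ler_normB (quotient p v h j t) (quotient p v h j t - z j (t, p)).
  by rewrite subKr -/C in h2 *; rewrite -/z in h1; lra.
apply: (@is_derive_uniform_limit R R (0 : R)^' _ (fun h => quotient p v h i)
  (fun h t => quad tm (fun j => y j (t, h *: v + p)) (quotient p v h ^~ t) i +
     quad tm (quotient p v h ^~ t) (fun j => y j (t, p)) i) _
  (fun t => quad tm (fun j => y j (t, p)) (fun j => z j (t, p)) i +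
     quad tm (fun j => z j (t, p)) (fun j => y j (t, p)) i) T).
- by apply: nearW => h t; exact: quotient_linearized.
- apply: nearW => h t.
  have cq j : {for t, continuous (quotient p v h j)}.
    exact: is_derive_continuous (quotient_linearized p v h j t).
  have cyt q j : {for t, continuous (fun t => y j (t, q))}.
    exact: is_derive_continuous (sol q j t).
  by apply: cvgD; apply: (@cvg_quad R I _ (nbhs t)) => j;
    by [exact: cq|exact: (cyt p)|exact: (cyt (h *: v + p))].
- move=> e e0; set N := quad_norm tm; set n : R := #|I|%:R.
  have N0 : 0 <= N := quad_norm_ge0 tm.
  have n0 : 0 <= n by exact: ler0n.
  pose e1 := e / 2 / (2 * N * K * n + 1).
  have den0 : 0 < 2 * N * K * n + 1 by rewrite ltr_wpDl// !mulr_ge0.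
  have e10 : 0 < e1 by rewrite !divr_gt0.
  have nu := quotient_uniform_cvg T dy e10.
  have e2 : 0 < e / 2 by rewrite divr_gt0.
  have := flow_initial_cvg0 p (N * M * (n * C)) cy0 => /cvgrPdist_le/(_ _ e2).
  move=> /(near0_line v) => ni.
  apply: filterS3 nu ni nK => h hu hi hK t tT.
  have -> : quad tm (fun j => y j (t, h *: v + p)) (quotient p v h ^~ t) i +
     quad tm (quotient p v h ^~ t) (fun j => y j (t, p)) i -
     (quad tm (fun j => y j (t, p)) (fun j => z j (t, p)) i +
      quad tm (fun j => z j (t, p)) (fun j => y j (t, p)) i) =
     quad tm (fun j => y j (t, h *: v + p))
       (fun j => quotient p v h j t - z j (t, p)) i +
     quad tm (fun j => quotient p v h j t - z j (t, p)) (fun j => y j (t, p)) i +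
     quad tm (fun j => y j (t, h *: v + p) - y j (t, p)) (fun j => z j (t, p)) i.
    by rewrite quadBr !quadBl; ring.
  have sumle (f : I -> R) b : (forall j, `|f j| <= b) -> \sum_j `|f j| <= n * b.
    move=> fb; apply: (@le_trans _ _ (\sum_(j : I) b)); first exact: ler_sum.
    by rewrite sumr_const mulr_natl.
  have s1 : \sum_j `|quotient p v h j t - z j (t, p)| <= n * e1.
    by apply: sumle => j; exact: hu.
  set S2 := \sum_j `|y j (0, h *: v + p) - y j (0, p)| in hi.
  have s2 : \sum_j `|y j (t, h *: v + p) - y j (t, p)| <= n * (C * S2).
    apply: sumle => j.
    exact: (quad_solution_lipschitz K0 (sol (h *: v + p)) (sol p) hK pK' j tT).
  have q1 := quad_lel tm (fun j => quotient p v h j t - z j (t, p)) i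
    (fun k => hK k t tT).
  have q2 := quad_ler tm (fun j => quotient p v h j t - z j (t, p)) i
    (fun k => pK' k t tT).
  have q3 := quad_ler tm (fun j => y j (t, h *: v + p) - y j (t, p)) i
    (fun k => zM k t tT).
  have NK0 : 0 <= N * K by rewrite mulr_ge0.
  have NM0 : 0 <= N * M by rewrite mulr_ge0.
  have m1 := ler_wpM2l NK0 s1; have m2 := ler_wpM2l NM0 s2.
  have e1le : 2 * (N * K * (n * e1)) <= e / 2.
    have : e1 * (2 * N * K * n + 1) = e / 2 by rewrite /e1 divfK// gt_eqF.
    by lra.
  move: hi; rewrite sub0r normrN => /(le_trans (ler_norm _)) hi.
  apply: le_trans (ler_normD _ _) _; apply: le_trans (lerD (ler_normD _ _) (lexx _)) _.
  by move: q1 q2 q3; rewrite -/N; lra.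
- move=> t tT; exact: flow_derivable.
- exact: t0T.
Qed.

End Flow.

Section FlowSmooth.
Context {R : realType} {P : normedModType R}.

(** The label moves first at time t, then time moves at the displaced label. Since that label varies
    with h, the time part needs joint continuity of the right-hand side. *)
Lemma flow_derive_dir (I : finType) (tm : I -> seq (R * I * I))
    (y : I -> R * P -> R) (v : R * P) (t : R) (p : P) :
  flow_solution tm y -> locally_bounded y ->
  (forall i, continuous (fun q => y i (0, q))) ->
  (forall i, derivable (fun q => y i (0, q)) p v.2) ->
  forall i, derivable (y i) (t, p) v /\
    'D_v (y i) (t, p) =
      v.1 * quad tm (y ^~ (t, p)) (y ^~ (t, p)) i + flow_derive y v.2 i (t, p).
Proof.
move=> sol lb cy dy i; case: v dy => s w /= dy.
set l := _ + _.
suff cv : h^-1 *: ((y i \o shift (t, p)) (h *: (s, w)) - y i (t, p))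
    @[h --> (0 : R)^'] --> l.
  by split; [exact: cvgP cv|exact: cvg_lim].
pose F q := quad tm (y ^~ q) (y ^~ q) i.
have cF : {for (t, p), continuous F}.
  have cyi := flow_continuous sol lb cy.
  by apply: (@cvg_quad R I _ (nbhs (t, p))) => j; exact: cyi.
have c1 : h^-1 * (y i (h * s + t, h *: w + p) - y i (t, h *: w + p))
    @[h --> (0 : R)^'] --> s * F (t, p).
  apply/cvgrPdist_le => e e0.
  pose e1 := e / (`|s| + 1).
  have s1 : 0 < `|s| + 1 by rewrite ltr_wpDl.
  have e10 : 0 < e1 by rewrite divr_gt0.
  have /cvgrPdist_le/(_ _ e10)[[A B] /= [[d /= d0 dA] pB] AB] := cF.
  have nB := near0_line w pB.
  have nd : \forall h \near (0 : R)^', `|h * s| < d.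
    have cs : h * s @[h --> (0 : R)] --> 0.
      rewrite -[X in _ --> X](mul0r s); apply: cvgM; [exact: cvg_id|exact: cvg_cst].
    move/cvgrPdist_lt : cs => /(_ _ d0)/nbhs_dnbhs; apply: filterS => h.
    by rewrite sub0r normrN.
  have nn : \forall h \near (0 : R)^', h != 0 by exact: nbhs_dnbhs_neq.
  apply: filterS3 nB nd nn => h hB hd hn.
  have := @mean_value_approx R (fun t => y i (t, h *: w + p))
    (fun t => F (t, h *: w + p)) t (h * s + t) (F (t, p)) e1
    (fun u _ => sol (h *: w + p) i u).
  rewrite addrK => mv.
  have {}mv : `|y i (h * s + t, h *: w + p) - y i (t, h *: w + p) - h * s * F (t, p)|
      <= e1 * `|h * s|.
    apply: mv => u us; rewrite distrC; apply: (AB (u, h *: w + p)); split=> //=.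
    by apply: dA; rewrite /ball_/= distrC; apply: le_lt_trans us _.
  rewrite -normrN opprB.
  have -> : h^-1 * (y i (h * s + t, h *: w + p) - y i (t, h *: w + p)) - s * F (t, p) =
    h^-1 * (y i (h * s + t, h *: w + p) - y i (t, h *: w + p) - h * s * F (t, p)).
    by field.
  rewrite normrM normfV ler_pdivrMl ?normr_gt0//; apply: le_trans mv _.
  rewrite normrM mulrCA ler_wpM2l// /e1 mulrAC ler_pdivrMr// ler_wpM2l// ?(ltW e0)//.
  by rewrite lerDl.
have c2 : h^-1 * (y i (t, h *: w + p) - y i (t, p)) @[h --> (0 : R)^'] -->
    flow_derive y w i (t, p).
  exact: (flow_derivable sol lb cy dy).
rewrite (_ : (fun h => _) = fun h : R =>
    h^-1 * (y i (h * s + t, h *: w + p) - y i (t, h *: w + p)) +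
    h^-1 * (y i (t, h *: w + p) - y i (t, p))).
  exact: cvgD c1 c2.
by apply/funext => h /=; rewrite [LHS]/GRing.scale/=; ring.
Qed.

(** [inl] indexes the fields y, [inr] their derivatives z. The product rule turns the monomial y_j
    y_k into y_j z_k + z_j y_k, so the class of quadratic systems is closed under variation, at the
    cost of doubling the index type. *)
Definition variation_terms (I : finType) (tm : I -> seq (R * I * I))
    (i : I + I) : seq (R * (I + I) * (I + I)) :=
  match i with
  | inl i => [seq (m.1.1, inl m.1.2, inl m.2) | m <- tm i]
  | inr i => [seq (m.1.1, inl m.1.2, inr m.2) | m <- tm i] ++
             [seq (m.1.1, inr m.1.2, inl m.2) | m <- tm i]
  end.

Definition variation (I : finType) (y z : I -> R * P -> R) (i : I + I) :=
  match i with inl i => y i | inr i => z i end.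

Lemma variation_solution (I : finType) (tm : I -> seq (R * I * I))
    (y : I -> R * P -> R) v :
  flow_solution tm y -> locally_bounded y ->
  (forall i, continuous (fun q => y i (0, q))) ->
  (forall i p, derivable (fun q => y i (0, q)) p v) ->
  flow_solution (variation_terms tm) (variation y (flow_derive y v)).
Proof.
move=> sol lb cy dy p [i|i] t /=.
  have := sol p i t; rewrite /quad /variation_terms big_map; exact.
have := flow_derive_linearized sol lb cy (dy^~ p) i t.
by rewrite /quad /variation_terms big_cat !big_map.
Qed.

(** Linearity lets Gronwall bound the derivative by its initial values, and those are locally
    bounded by continuity. *)
Lemma variation_bounded (I : finType) (tm : I -> seq (R * I * I))
    (y : I -> R * P -> R) v :
  flow_solution tm y -> locally_bounded y ->
  (forall i, continuous (fun q => y i (0, q))) ->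
  (forall i p, derivable (fun q => y i (0, q)) p v) ->
  (forall i, continuous ('D_v (fun q => y i (0, q)))) ->
  locally_bounded (variation y (flow_derive y v)).
Proof.
move=> sol lb cy dy cD p T; have [K K0 pK] := lb p T.
pose S q : R := \sum_j `|'D_v (fun q => y j (0, q)) q|.
have cS : S q @[q --> p] --> S p.
  by apply: cvg_bigsum => j; apply: cvg_norm; exact: cD.
have nS : \forall q \near p, S q <= S p + 1.
  move/cvgrPdist_le : cS => /(_ 1 ltr01); apply: filterS => q.
  by rewrite ler_norml; lra.
have S0 q : 0 <= S q by exact: sumr_ge0.
set C := flow_const tm K T; have C0 : 0 <= C := flow_const_ge0 tm K T.
exists (K + C * (S p + 1)).
  by rewrite addr_ge0// mulr_ge0// addr_ge0.
apply: filterS2 nS pK => q qS qK [i|i] t tT /=.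
  by apply: le_trans (qK i t tT) _; rewrite lerDl mulr_ge0// addr_ge0.
have := quad_linearized_bound K0 (flow_derive_linearized sol lb cy (dy^~ q)) qK qK i tT.
move=> /le_trans; apply; apply: (@le_trans _ _ (C * S q)); first by [].
by rewrite -[leLHS]add0r lerD// ler_wpM2l.
Qed.

(** The induction ranges over all index types and systems, because the step uses it for the doubled
    one. In a directional derivative the time part is polynomial in the fields, while the label part
    is a component of the doubled system, with initial data y and its derivative at time 0. *)
Lemma Ck_flow n (I : finType) (tm : I -> seq (R * I * I)) (y : I -> R * P -> R) :
  flow_solution tm y -> locally_bounded y ->
  (forall i, Ck_in n setT (fun q => y i (0, q))) ->
  forall i, Ck_in n setT (y i).
Proof.
elim: n I tm y => [|n IH] I tm y sol lb Cy i.
  by apply/Ck0P; apply: flow_continuous sol lb _ i => j; exact/Ck0P.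
have cy j := Ck_continuous (Cy j).
have dy v j p : derivable (fun q => y j (0, q)) p v.
  by have /CkSP[_ /(_ v)[]] := Cy j.
have CD v j : Ck_in n setT ('D_v (fun q => y j (0, q))).
  by have /CkSP[_ /(_ v)[]] := Cy j.
apply/CkSP; split; first exact: flow_continuous sol lb cy i.
move=> v; split.
  by move=> [t p]; have [] := flow_derive_dir t sol lb cy (dy v.2 ^~ p) i.
have -> : 'D_v (y i) =
    (fun q => v.1 * quad tm (y ^~ q) (y ^~ q) i + flow_derive y v.2 i q).
  apply/funext => -[t p].
  by have [_ ->] := flow_derive_dir t sol lb cy (dy v.2 ^~ p) i.
have Cyn j : Ck_in n setT (y j).
  by apply: (IH I tm y sol lb) => k; exact: CkS_Ck.
apply: CkD.
  apply: CkM; first exact: Ck_cst.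
  by apply: Ck_bigsum => m; apply: CkM; [exact: Ck_cst|exact: CkM].
have bV := variation_bounded sol lb cy (dy v.2) (fun j => Ck_continuous (CD v.2 j)).
apply: (IH _ _ _ (variation_solution sol lb cy (dy v.2)) bV _ (inr i)).
by case=> j /=; [exact: CkS_Ck|exact: CD].
Qed.

End FlowSmooth.

(** * Spectra of real 2 x 2 matrices *)

Lemma ord2_cases (j : 'I_2) : j = 0 \/ j = 1.
Proof. by case: j => -[|[|//]] ?; [left|right]; exact/val_inj. Qed.

Lemma sum_ord2 (V : nmodType) (f : 'I_2 -> V) : \sum_j f j = f 0 + f 1.
Proof.
rewrite !big_ord_recl big_ord0 addr0; congr (f _ + f _); exact/val_inj.
Qed.

Lemma char_poly22 (S : comNzRingType) (A : 'M[S]_2) :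
  char_poly A = 'X^2 - (\tr A)%:P * 'X + (A 0 0 * A 1 1 - A 0 1 * A 1 0)%:P.
Proof.
have e1 : lift ord0 ord0 = 1 :> 'I_2 by apply/val_inj.
have e2 : lift 1 ord0 = 0 :> 'I_2 by apply/val_inj.
have o : ord0 = 0 :> 'I_2 by apply/val_inj.
rewrite /char_poly (expand_det_row _ ord0) !big_ord_recl big_ord0 /cofactor !det_mx11 !mxE.
rewrite /mxtrace !big_ord_recl big_ord0 !e1 !o !e2 /= !mulr1n !mulr0n.
rewrite !rmorphB !rmorphD/= !rmorphM/= rmorph0; ring.
Qed.

Section Eigenvalues.
Context {R : realType}.
Implicit Types (A : 'M[R]_2) (z : 'I_2 -> R[i]).

Lemma eigenvalues_ofP A z : eigenvalues_of A z <->
  z 0 + z 1 = (\tr A)%:C /\ z 0 * z 1 = (A 0 0 * A 1 1 - A 0 1 * A 1 0)%:C.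
Proof.
have e1 : lift ord0 ord0 = 1 :> 'I_2 by apply/val_inj.
have o : ord0 = 0 :> 'I_2 by apply/val_inj.
have prodE : \prod_(i < 2) ('X - (z i)%:P) =
    'X^2 - (z 0 + z 1)%:P * 'X + (z 0 * z 1)%:P.
  by rewrite !big_ord_recl big_ord0 e1 o rmorphD rmorphM /=; ring.
rewrite /eigenvalues_of char_poly22 prodE trace_map_mx !mxE -!rmorphM -rmorphB/=.
split=> [E|[-> ->]//].
have co (s d : R[i]) : ('X^2 - s%:P * 'X + d%:P)`_0 = d /\
    ('X^2 - s%:P * 'X + d%:P)`_1 = - s.
  rewrite !(coefD, coefN, coefXn, coefMX, coefC) /=.
  by rewrite !sub0r oppr0 add0r addr0.
split.
  have := congr1 (fun p : {poly R[i]} => p`_1) E.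
  by rewrite (co _ _).2 (co _ _).2 => /oppr_inj ->.
have := congr1 (fun p : {poly R[i]} => p`_0) E.
by rewrite (co _ _).1 (co _ _).1 => ->.
Qed.

(** A real trace forces opposite imaginary parts; the imaginary part of the determinant is then b
    (a' - a), so the real parts agree. *)
Lemma eigenvalues_nonreal A z : eigenvalues_of A z -> complex.Im (z 0) <> 0 ->
  let a := complex.Re (z 0) in let b := complex.Im (z 0) in
  [/\ z 0 = a +i* b, z 1 = a +i* - b, \tr A = a + a
    & A 0 0 * A 1 1 - A 0 1 * A 1 0 = a ^+ 2 + b ^+ 2].
Proof.
move=> /eigenvalues_ofP[]; case: (z 0) => a b; case: (z 1) => a' b' /=.
move=> [ta bb] [dt ab] /eqP bn0.
have b'E : b' = - b by apply/eqP; rewrite -addr_eq0 addrC bb.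
have /eqP : b * (a' - a) = 0 by move: ab; rewrite b'E; lra.
rewrite mulf_eq0 (negbTE bn0) subr_eq0/=.
move=> /eqP aa; rewrite aa in ta dt *; split=> //; first by rewrite b'E.
by rewrite -dt b'E; ring.
Qed.

Lemma eigenvalues_of_conj A z (a b : R) :
  z 0 = a +i* b -> z 1 = a +i* - b -> \tr A = a + a ->
  A 0 0 * A 1 1 - A 0 1 * A 1 0 = a ^+ 2 + b ^+ 2 -> eigenvalues_of A z.
Proof.
move=> z0 z1 tA dA; apply/eigenvalues_ofP; rewrite z0 z1 tA dA; split.
  by apply/eqP; rewrite eq_complex/= eqxx subrr eqxx.
by apply/eqP; rewrite eq_complex/=; apply/andP; split; apply/eqP; ring.
Qed.

End Eigenvalues.

(** * Matrix-valued functions of class C^k *)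

Section CkMatrix.
Context {R : realType} {E : normedModType R}.

Lemma Ck_entry m n k (f : E -> 'M[R]_(m, n)) i j : Ck_in k setT f ->
  Ck_in k setT (fun p => f p i j).
Proof.
elim: k f => [|k IH] f.
  move=> /Ck0P cf; apply/Ck0P => p.
  by apply: (@cvg_comp _ _ _ f (fun A => A i j)); [exact: cf|exact: coord_continuous].
move=> /CkSP[cf df]; apply/CkSP; split.
  move=> p.
  by apply: (@cvg_comp _ _ _ f (fun A => A i j)); [exact: cf|exact: coord_continuous].
move=> v; have [f1 f2] := df v; split.
  by move=> p; have /derivable_mxP := f1 p; exact.
rewrite (_ : 'D_v _ = fun p => 'D_v f p i j); first exact: IH.
by apply/funext => p; rewrite derive_mx// mxE.
Qed.

Lemma Ck_scale (W : normedModType R) k (g : E -> R) (w : W) : Ck_in k setT g ->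
  Ck_in k setT (fun p => g p *: w).
Proof.
elim: k g => [|k IH] g.
  by move=> /Ck0P cg; apply/Ck0P => p; apply: cvgZl; exact: cg.
move=> /CkSP[cg dg]; apply/CkSP; split; first by move=> p; apply: cvgZl; exact: cg.
move=> v; have [g1 g2] := dg v.
have dw p : h^-1 *: (((fun p => g p *: w) \o shift p) (h *: v) - g p *: w)
    @[h --> 0^'] --> 'D_v g p *: w.
  under eq_fun do rewrite /= -scalerBl scalerA.
  by apply: cvgZl; exact: g1.
split; first by move=> p; apply: cvgP (dw p).
rewrite (_ : 'D_v _ = fun p => 'D_v g p *: w); first exact: IH.
by apply/funext => p; apply: cvg_lim => //; exact: dw.
Qed.

Lemma Ck_matrix m n k (f : E -> 'M[R]_(m, n)) :
  (forall i j, Ck_in k setT (fun p => f p i j)) -> Ck_in k setT f.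
Proof.
move=> fij.
rewrite (_ : f = fun p => \sum_i \sum_j f p i j *: delta_mx i j).
  by apply: Ck_bigsum => i; apply: Ck_bigsum => j; exact: Ck_scale.
by apply/funext => p; exact: matrix_sum_delta.
Qed.

End CkMatrix.

(** * Classical solutions along particle paths *)

(** A quadratic field is only locally Lipschitz; compactness of the closed time interval bounds both
    solutions and thereby supplies the Lipschitz constant. *)
Lemma quad_solution_unique (R : realType) (I : finType) (tm : I -> seq (R * I * I))
    (y y' : I -> R -> R) (T : R) :
  (forall i, {within `[0, T], continuous (y i)}) ->
  (forall i, {within `[0, T], continuous (y' i)}) ->
  (forall i t, 0 < t < T -> is_derive t 1 (y i) (quad tm (y ^~ t) (y ^~ t) i)) ->
  (forall i t, 0 < t < T -> is_derive t 1 (y' i) (quad tm (y' ^~ t) (y' ^~ t) i)) ->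
  (forall i, y i 0 = y' i 0) ->
  forall i t, 0 <= t <= T -> y i t = y' i t.
Proof.
move=> cy cy' dy dy' y0 i t /[dup] tT /andP[t0 tT'].
have T0 : 0 <= T by exact: le_trans tT'.
have bnd (z : I -> R -> R) : (forall j, {within `[0, T], continuous (z j)}) ->
    exists2 K, 0 <= K & forall j s, 0 <= s <= T -> `|z j s| <= K.
  move=> cz.
  have /choice[c cP] : forall j, exists c, forall s, 0 <= s <= T -> `|z j s| <= c.
    move=> j; have cn : {within `[0, T], continuous (fun s => `|z j s|)}.
      by move=> s; apply: cvg_norm; exact: cz.
    have [c _ cP] := EVT_max T0 cn.
    by exists `|z j c| => s sT; apply: cP; rewrite in_itv.
  exists (\sum_j `|c j|); first exact: sumr_ge0.
  move=> j s sT; apply: le_trans (cP j s sT) _; apply: le_trans (ler_norm _) _.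
  by rewrite (bigD1 j)//= lerDl sumr_ge0.
have [K1 K10 yK] := bnd y cy; have [K2 K20 yK'] := bnd y' cy'.
have := @gronwall R I (fun j => y j - y' j)
  (fun j s => quad tm (y ^~ s) (y ^~ s) j - quad tm (y' ^~ s) (y' ^~ s) j)
  (quad_norm tm * K1 + quad_norm tm * K2) 0 T _ (lexx 0) _ _ _ i t tT.
rewrite addr0 (_ : \sum_j _ = 0); last first.
  by apply: big1 => j _; rewrite -[(_ - _) 0]/(y j 0 - y' j 0) y0 subrr normr0.
rewrite mulr0 normr_le0 => h; apply/eqP; rewrite -subr_eq0; apply: h.
- by rewrite addr_ge0// mulr_ge0// quad_norm_ge0.
- by move=> j s sT; apply: is_deriveB; [exact: dy|exact: dy'].
- by move=> j s; apply: cvgB; [exact: cy|exact: cy'].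
- move=> j s /andP[s0 sT]; have sT' : 0 <= s <= T by rewrite !ltW.
  rewrite addr0 quadB; apply: le_trans (ler_normD _ _) _.
  have := quad_lel tm (fun j => y j s - y' j s) j (fun k => yK k s sT').
  have := quad_ler tm (fun j => y j s - y' j s) j (fun k => yK' k s sT').
  rewrite -[\sum_j0 `|(y j0 - y' j0) s|]/(\sum_j0 `|y j0 s - y' j0 s|); lra.
Qed.

Lemma is_derive_eps (R : realType) (f : R -> R) (l t : R) : is_derive t 1 f l ->
  forall e, 0 < e -> \forall s \near t, `|f s - f t - (s - t) * l| <= e * `|s - t|.
Proof.
move=> [fd <-] e e0; have /cvgrPdist_le/(_ _ e0)[d /= d0 dP] := fd.
exists d => //= s ts; have [->|st] := eqVneq s t; first by rewrite !subrr mul0r subr0 normr0 mulr0.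
have st0 : s - t != 0 by rewrite subr_eq0.
have := dP (s - t); rewrite /= sub0r normrN (distrC s) => /(_ ts st0).
rewrite [(s - t) *: 1]mulr1 subrK /GRing.scale/= -/('D_1 f t) => h.
have -> : f s - f t - (s - t) * 'D_1 f t =
    - ((s - t) * ('D_1 f t - (s - t)^-1 * (f s - f t))) by field.
by rewrite normrN normrM mulrC (distrC s) ler_wpM2r.
Qed.

Section Interior.
Context {R : realType} {E W : normedModType R}.
Implicit Types (D : set E) (p v : E) (f : E -> W).

Lemma is_derive_interior D f p v : nbhs p D -> derivable_in D f p v ->
  is_derive p v f (derive_in D f v p).
Proof.
move=> pD; have nD := near0_line v pD.
have E_ : within [set h | D (h *: v + p)] 0^' = (0 : R)^'.
  apply/seteqP; split=> A /= hA; last by apply: filterS hA => h Ah _.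
  by apply: filterS2 nD hA => h Dh; exact.
by rewrite /derivable_in /derive_in E_ => df; exact: DeriveDef.
Qed.

Lemma within_continuous_interior (U V : topologicalType) (D : set U) (g : U -> V) (x : U) :
  {within D, continuous g} -> nbhs x D -> {for x, continuous g}.
Proof.
move=> /subspace_continuousP cg pD A gA.
have := cg x (nbhs_singleton pD) A gA; rewrite /within /= => h.
by apply: filterS2 pD h => q Dq; exact.
Qed.

End Interior.

(** * The chain rule along a path *)

Section ChainRule.
Context {R : realType} {E : normedModType R}.

(** The base point q varies near q0 while the slope [g q0] stays fixed; this uniformity allows
    increments in successive directions to be chained. *)
Lemma directional_increment (f g : E -> R) (v q0 : E) :
  (\forall q \near q0, is_derive q v f (g q)) -> {for q0, continuous g} ->
  forall e, 0 < e -> exists2 d, 0 < d & forall q c, `|q - q0| < d -> `|c| < d ->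
    `|f (c *: v + q) - f q - c * g q0| <= e * `|c|.
Proof.
move=> dfg cg e e0.
have ng : \forall q \near q0, `|g q0 - g q| <= e by move/cvgrPdist_le : cg; apply.
have nn : \forall q \near q0, is_derive q v f (g q) /\ `|g q0 - g q| <= e.
  exact: filterI.
have [d /= d0 dP] := (nbhs_normP _ _).1 nn.
have v1 : 0 < `|v| + 1 by rewrite ltr_wpDl.
exists (d / (`|v| + 1)); first by rewrite divr_gt0.
move=> q c qd cd.
have inball s : `|s| <= `|c| -> `|q0 - (s *: v + q)| < d.
  move=> sc; rewrite opprD addrCA; apply: le_lt_trans (ler_normD _ _) _.
  rewrite normrN normrZ (distrC q0 q).
  have : d = d / (`|v| + 1) * (`|v| + 1) by rewrite divfK// gt_eqF.
  have : `|s| * `|v| <= d / (`|v| + 1) * `|v| by rewrite ler_wpM2r// (le_trans sc)// ltW.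
  lra.
have := @mean_value_approx R (fun s => f (s *: v + q)) (fun s => g (s *: v + q))
  0 c (g q0) e.
rewrite subr0 scale0r add0r; apply.
- move=> s; rewrite subr0 => /inball/dP[/= [fd fE] _].
  have lim : h^-1 *: ((f \o shift (s *: v + q)) (h *: v) - f (s *: v + q))
      @[h --> 0^'] --> g (s *: v + q) by rewrite -fE; exact: fd.
  have lim2 : h^-1 *: (((fun s => f (s *: v + q)) \o shift s) (h *: 1) - f (s *: v + q))
      @[h --> 0^'] --> g (s *: v + q).
    rewrite (_ : (fun h => _) = fun h => h^-1 *: ((f \o shift (s *: v + q)) (h *: v)
       - f (s *: v + q)))//.
    by apply/funext => h /=; rewrite [h *: 1]mulr1 scalerDl addrA.
  by apply: DeriveDef; [exact: cvgP lim2|exact: cvg_lim].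
- by move=> s; rewrite subr0 => /inball/dP[/= _]; rewrite distrC.
Qed.

End ChainRule.

Lemma norm_increment_le (R : realType) (d xi u e : R) :
  e <= 1 -> `|xi - d * u| <= e * `|d| -> `|xi| <= (`|u| + 1) * `|d|.
Proof.
move=> e1 h; have := ler_normD (xi - d * u) (d * u); rewrite subrK normrM.
by have := ler_wpM2r (normr_ge0 d) e1; lra.
Qed.

(** The remainders contribute 1, |u0| + 1 and |u1| + 1, as |x_j| <= (|u_j| + 1) |d|; replacing x_j
    by d u_j costs |g0| and |g1|. *)
Lemma norm_sum5_le (R : realType) (r0 r1 r2 x0 x1 g0 g1 u0 u1 d e1 e : R) :
  0 < e1 -> e1 <= 1 -> e1 * (3 + `|u0| + `|u1| + `|g0| + `|g1|) <= e ->
  `|r0| <= e1 * `|d| -> `|r1| <= e1 * `|x0| -> `|r2| <= e1 * `|x1| ->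
  `|x0 - d * u0| <= e1 * `|d| -> `|x1 - d * u1| <= e1 * `|d| ->
  `|r0 + r1 + r2 + (x0 - d * u0) * g0 + (x1 - d * u1) * g1| <= e * `|d|.
Proof.
move=> e10 e11 eB h0 h1 h2 k0 k1.
have a0 := norm_increment_le e11 k0; have a1 := norm_increment_le e11 k1.
have b0 : `|(x0 - d * u0) * g0| <= e1 * `|d| * `|g0| by rewrite normrM ler_wpM2r.
have b1 : `|(x1 - d * u1) * g1| <= e1 * `|d| * `|g1| by rewrite normrM ler_wpM2r.
apply: le_trans (ler_normD _ _) _; apply: le_trans (lerD (ler_normD _ _) (lexx _)) _.
apply: le_trans (lerD (lerD (ler_normD _ _) (lexx _)) (lexx _)) _.
apply: le_trans (lerD (lerD (lerD (ler_normD _ _) (lexx _)) (lexx _)) (lexx _)) _.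
have m0 := ler_wpM2l (ltW e10) a0; have m1 := ler_wpM2l (ltW e10) a1.
have := ler_wpM2r (normr_ge0 d) eB.
by clear -m0 m1 b0 b1 h0 h1 h2; lra.
Qed.

Section AlongPath.
Context {R : realType}.
Notation space := 'rV[R]_2.
Variables (T : R) (x : R -> space).
Notation D := (@slab R `[0, T[).

Lemma nbhs_slab t (q : space) : 0 < t < T -> nbhs (t, q) D.
Proof.
move=> tT; exists (`]0, T[%classic, setT) => /=.
  by split; [apply: near_in_itvoo; rewrite in_itv|exact: filterT].
by move=> [s q'] [/=]; rewrite /slab/= !in_itv/= => /andP[s0 sT] _; rewrite ltW.
Qed.

(** Class C^1 is expressed through directional derivatives, so the move from (t, x t) to (s, x s) is
    broken into three legs parallel to the axes, with corners [q1 s] and [q2 s]. *)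
Lemma path_derive (f : R * space -> R) (u : R -> space) t : 0 < t < T ->
  is_derive t 1 x (u t) -> Ck_in 1 D f ->
  is_derive t 1 (fun s => f (s, x s))
    (derive_in D f et (t, x t) + \sum_j u t 0 j * derive_in D f (ex j) (t, x t)).
Proof.
move=> tT dx [cf df].
set q0 := (t, x t).
have nD : \forall q \near q0, 0 < q.1 < T.
  exists (`]0, T[%classic, setT) => /=.
    by split; [apply: near_in_itvoo; rewrite in_itv|exact: filterT].
  by move=> [s q'] [/=]; rewrite in_itv.
have dnear v : \forall q \near q0, is_derive q v f (derive_in D f v q).
  apply: filterS nD => -[s q] /= sT; apply: is_derive_interior; first exact: nbhs_slab.
  have [h _] := df v; apply: h; rewrite /slab/= in_itv/=.
  by case/andP : sT => s0 ->; rewrite ltW.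
have cnear v : {for q0, continuous (derive_in D f v)}.
  have [_ [h _]] := df v; apply: within_continuous_interior h _; exact: nbhs_slab.
set gt := derive_in D f et q0; pose g j := derive_in D f (ex j) q0.
have cx : {for t, continuous x}.
  by case: dx => dx _; apply: differentiable_continuous; exact/derivable1_diffP.
have dxj j : is_derive t 1 (fun s => x s 0 j) (u t 0 j).
  case: dx => dx dE; have /derivable_mxP h := dx.
  by apply: DeriveDef => //; rewrite -dE derive_mx// mxE.
pose xi j s := x s 0 j - x t 0 j.
have cxi j : xi j s @[s --> t] --> 0.
  rewrite -(subrr (x t 0 j)); apply: cvgB; last exact: cvg_cst.
  exact: is_derive_continuous (dxj j).
pose q1 s : R * space := (s, x t).
pose q2 s : R * space := xi 0 s *: ex 0 + q1 s.
have q3E s : xi 1 s *: ex 1 + q2 s = (s, x s).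
  rewrite /q2 /q1 /ex; congr (_, _) => /=.
    by rewrite !scaler0 !add0r.
  by apply/rowP => j; rewrite !mxE; have [->|->] := ord2_cases j; rewrite /xi /=; ring.
apply: is_derive_epsP => e e0.
rewrite (_ : \sum_j _ = u t 0 0 * g 0 + u t 0 1 * g 1); last first.
  by rewrite sum_ord2.
pose B := 3 + `|u t 0 0| + `|u t 0 1| + `|g 0| + `|g 1|.
have B0 : 0 < B by rewrite /B !ltr_wpDr.
pose e1 := Num.min 1 (e / B).
have e10 : 0 < e1 by rewrite lt_min ltr01 divr_gt0.
have e11 : e1 <= 1 by rewrite ge_min lexx.
have e1B : e1 * B <= e by rewrite -ler_pdivlMr// ge_min lexx orbT.
have [d d0 dP] := directional_increment (dnear et) (cnear et) e10.
have [d' d0' dP'] := directional_increment (dnear (ex 0)) (cnear (ex 0)) e10.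
have [d'' d0'' dP''] := directional_increment (dnear (ex 1)) (cnear (ex 1)) e10.
have cid : (s : R) @[s --> t] --> t by exact: cvg_id.
have cq1 : q1 s @[s --> t] --> q0.
  by apply: (@cvg_pair _ _ _ _ (nbhs t) (nbhs (x t))); [exact: cid|exact: cvg_cst].
have cq2 : q2 s @[s --> t] --> q0.
  have cZ : xi 0 s *: ex 0 @[s --> t] --> 0 *: (ex 0 : R * space) by exact: cvgZl.
  by have := cvgD cZ cq1; rewrite scale0r add0r; exact.
have n1 : \forall s \near t, `|s - t| < d.
  by move/cvgrPdist_lt : cid => /(_ _ d0); apply: filterS => s; rewrite distrC.
have n2 : \forall s \near t, `|q1 s - q0| < d' /\ `|xi 0 s| < d'.
  move/cvgrPdist_lt : cq1 => /(_ _ d0'); move/cvgrPdist_lt : (cxi 0) => /(_ _ d0').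
  by apply: filterS2 => s; rewrite sub0r normrN => h1 h2; rewrite distrC.
have n3 : \forall s \near t, `|q2 s - q0| < d'' /\ `|xi 1 s| < d''.
  move/cvgrPdist_lt : cq2 => /(_ _ d0''); move/cvgrPdist_lt : (cxi 1) => /(_ _ d0'').
  by apply: filterS2 => s; rewrite sub0r normrN => h1 h2; rewrite distrC.
have FF := nbhs_filter t.
have n23 := @filterI _ _ FF _ _ n2 n3.
have nx := @filterI _ _ FF _ _ (is_derive_eps (dxj 0) e10) (is_derive_eps (dxj 1) e10).
apply: filterS3 n1 n23 nx => s h1 [[h2 h2'] [h3 h3']] [x0 x1].
have := dP q0 (s - t); rewrite subrr normr0 => /(_ d0 h1).
rewrite (_ : (s - t) *: et + q0 = q1 s); last first.
  by rewrite /q1 /q0 /et; congr (_, _) => /=; rewrite ?scaler0 ?add0r// [_ *: _]mulr1 subrK.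
have := dP' _ _ h2 h2'; rewrite -/(q2 s) -/(g 0).
have := dP'' _ _ h3 h3'; rewrite q3E -/(g 1) -/gt.
move: x0 x1; rewrite -/(xi 0 s) -/(xi 1 s).
set U0 := u t 0 0; set U1 := u t 0 1 => x0 x1 i3 i2 i1.
have -> : f (s, x s) - f (t, x t) - (s - t) * (gt + (U0 * g 0 + U1 * g 1)) =
  (f (q1 s) - f q0 - (s - t) * gt) + (f (q2 s) - f (q1 s) - xi 0 s * g 0)
  + (f (s, x s) - f (q2 s) - xi 1 s * g 1)
  + (xi 0 s - (s - t) * U0) * g 0 + (xi 1 s - (s - t) * U1) * g 1.
  rewrite /q0; move: (f _) (f (q1 s)) (f (q2 s)) (f _) (xi 0 s) (xi 1 s) => F1 F2 F3 F4 X0 X1.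
  move: (gt) (g 0) (g 1) (U0) (U1) => G G0 G1 V0 V1.
  by clear; ring.
exact: norm_sum5_le e10 e11 e1B i1 i2 i3 x0 x1.
Qed.

End AlongPath.

Lemma density_equation_Re (R : realType) (s r : R) (z0 z1 : R[i]) :
  s%:C + r%:C * (z0 + z1) = 0 -> s = - r * (complex.Re z0 + complex.Re z1).
Proof.
case: z0 z1 => [a b] [a' b'] /(congr1 (@complex.Re R)) /= h.
by apply/eqP; rewrite -subr_eq0 -h; apply/eqP; ring.
Qed.

Lemma eigenvalue_equation_ReIm (R : realType) (dR dI c : R) (gR gI v : 'I_2 -> R)
    (z : R[i]) :
  (dR +i* dI) + \sum_j (v j)%:C * (gR j +i* gI j) + z ^+ 2 = c%:C ->
  dR + \sum_j v j * gR j = - complex.Re z ^+ 2 + complex.Im z ^+ 2 + c /\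
  dI + \sum_j v j * gI j = - 2 * (complex.Re z * complex.Im z).
Proof.
case: z => a b; rewrite !big_ord_recl !big_ord0 expr2 => /= -[hR hI].
by split; move: hR hI; lra.
Qed.

Section SpectralState.
Context {R : realType}.
Variable k : R.

(* [None] is the density, [Some None] the constant 1, and [Some (Some (i, true))],
   [Some (Some (i, false))] are the real and imaginary parts of the i-th eigenvalue. *)
Definition spectral_index := option (option ('I_2 * bool)).

Definition spectral_terms (j : spectral_index) :
    seq (R * spectral_index * spectral_index) :=
  match j with
  | None => [:: (-1, None, Some (Some (0, true))); (-1, None, Some (Some (1, true)))]
  | Some None => [::]
  | Some (Some (i, true)) =>
      [:: (-1, Some (Some (i, true)), Some (Some (i, true)));
          (1, Some (Some (i, false)), Some (Some (i, false)));
          (k / 2, None, Some None)]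
  | Some (Some (i, false)) => [:: (-2, Some (Some (i, true)), Some (Some (i, false)))]
  end.

Definition spectral_state (r : R -> R) (l : 'I_2 -> R -> R[i]) (j : spectral_index) (t : R) : R :=
  match j with
  | None => r t
  | Some None => 1
  | Some (Some (i, true)) => complex.Re (l i t)
  | Some (Some (i, false)) => complex.Im (l i t)
  end.

Lemma spectral_state_derive (r : R -> R) (l : 'I_2 -> R -> R[i]) (t : R) :
  is_derive t 1 r (- r t * (complex.Re (l 0 t) + complex.Re (l 1 t))) ->
  (forall i, is_derive t 1 (fun s => complex.Re (l i s))
     (- complex.Re (l i t) ^+ 2 + complex.Im (l i t) ^+ 2 + k / 2 * r t)) ->
  (forall i, is_derive t 1 (fun s => complex.Im (l i s))
     (- 2 * (complex.Re (l i t) * complex.Im (l i t)))) ->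
  forall j, is_derive t 1 (spectral_state r l j)
    (quad spectral_terms (spectral_state r l ^~ t) (spectral_state r l ^~ t) j).
Proof.
move=> dr dre dim; rewrite /quad /spectral_terms => -[[[i []]|]|].
- rewrite !big_cons big_nil /=; have d := dre i.
  by apply: is_derive_eq; ring.
- rewrite big_seq1 /=; exact: dim.
- by rewrite big_nil; exact: is_derive_cst.
- by rewrite !big_cons big_nil /=; apply: is_derive_eq; ring.
Qed.

End SpectralState.

Section AlongPath.
Context {R : realType}.
Notation space := 'rV[R]_2.

(** Near t the quotients are bounded by [|l| + 1], which is a Lipschitz estimate at t; it covers the
    one-sided case at time 0. *)
Lemma derivable_in_continuous (W : normedModType R) (D : set R) (f : R -> W) t :
  derivable_in D f t 1 -> f s @[s --> within D (nbhs t)] --> f t.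
Proof.
move=> /cvg_ex[/= l /cvgrPdist_le/(_ 1 ltr01)[d /= d0 dP]].
apply/cvgrPdist_le => e e0; set c := `|l| + 1.
have c0 : 0 < c by rewrite ltr_wpDl.
have m0 : 0 < Num.min d (e / c) by rewrite lt_min d0 divr_gt0.
exists (Num.min d (e / c)) => // s; rewrite /ball_/= lt_min => /andP[std ste] Ds.
have [->|st] := eqVneq s t; first by rewrite subrr normr0 ltW.
have st0 : s - t != 0 by rewrite subr_eq0.
have := dP (s - t); rewrite /= sub0r normrN (distrC s) => /(_ std st0).
rewrite [(s - t) *: 1]mulr1 subrK => /(_ Ds) h.
have hc : `|(s - t)^-1 *: (f s - f t)| <= c.
  by have := ler_normB l (l - (s - t)^-1 *: (f s - f t)); rewrite subKr /c; lra.
move: hc; rewrite normrZ normfV ler_pdivrMl ?normr_gt0// => hc.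
rewrite distrC; apply: le_trans hc _; rewrite distrC.
by rewrite -ler_pdivlMr// ltW.
Qed.

Lemma path_continuous (f : R * space -> R) (x : R -> space) (T tau : R) : tau < T ->
  (forall t, 0 <= t < T -> derivable_in `[0, T[ x t 1) ->
  {within slab `[0, T[, continuous f} ->
  {within `[0, tau], continuous (fun s => f (s, x s))}.
Proof.
move=> tauT dx /subspace_continuousP cf; apply/subspace_continuousP => t.
rewrite /= in_itv/= => /andP[t0 ttau].
have tT : 0 <= t < T by rewrite t0 (le_lt_trans ttau).
have sub : `[0, tau] `<=` `[0, T[.
  by move=> s /=; rewrite !in_itv/= => /andP[-> h]; exact: le_lt_trans tauT.
have cx : x s @[s --> within `[0, tau] (nbhs t)] --> x t.
  have h := derivable_in_continuous (dx t tT).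
  exact: cvg_trans (cvg_app _ (within_subset (nbhs_filter t) sub)) h.
have cp : (s, x s) @[s --> within `[0, tau] (nbhs t)] --> (t, x t).
  apply: (@cvg_pair _ _ _ _ (nbhs t) (nbhs (x t))) => //.
  exact: cvg_within.
have Dt : slab `[0, T[ (t, x t) by rewrite /slab/= in_itv.
move=> A fA.
have h : \forall s \near t, s \in `[0, tau] -> slab `[0, T[ (s, x s) -> A (f (s, x s)).
  exact: cp _ (cf _ Dt A fA).
suff : \forall s \near t, s \in `[0, tau] -> A (f (s, x s)) by [].
by apply: filterS h => s h stau; apply: h => //; exact: sub.
Qed.

Variables (k T : R) (u : R * space -> space) (r : R * space -> R).
Variables (l : 'I_2 -> R * space -> R[i]) (x : R -> space) (alpha : space).
Hypothesis sol : spectral_solution k `[0, T[ u r l.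
Hypothesis path : particle_path `[0, T[ u alpha x.
Notation D := (@slab R `[0, T[).

Lemma spectral_along_path t : 0 < t < T ->
  forall j, is_derive t 1 (spectral_state (fun s => r (s, x s)) (fun i s => l i (s, x s)) j)
    (quad (spectral_terms k)
      (spectral_state (fun s => r (s, x s)) (fun i s => l i (s, x s)) ^~ t)
      (spectral_state (fun s => r (s, x s)) (fun i s => l i (s, x s)) ^~ t) j).
Proof.
move=> /[dup] tT /andP[t0 tT']; case: sol => Cr Cl er el; case: path => x0 dx.
have It : (`[0, T[%classic : set R) t by rewrite /= in_itv/= ltW.
have Dt : D (t, x t) by exact: It.
have nI : nbhs t (`[0, T[%classic : set R).
  have : nbhs t (`]0, T[%classic : set R) by apply: near_in_itvoo; rewrite in_itv.
  by apply: filterS => s /=; rewrite !in_itv/= => /andP[s0 ->]; rewrite ltW.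
have xd : is_derive t 1 x (u (t, x t)).
  by have [d <-] := dx t It; exact: is_derive_interior.
have pd f : Ck_in 1 D f -> is_derive t 1 (fun s => f (s, x s))
    (derive_in D f et (t, x t) + \sum_j u (t, x t) 0 j * derive_in D f (ex j) (t, x t)).
  by move=> Cf; apply: (@path_derive R T x f (fun s => u (s, x s))).
apply: (@spectral_state_derive R k (fun s => r (s, x s)) (fun i s => l i (s, x s)) t).
- have d := pd r Cr; apply: is_derive_eq.
  exact: density_equation_Re (er _ Dt).
- move=> i; have [CR CI] := Cl i; have d := pd _ CR; apply: is_derive_eq.
  by have [-> _] := eigenvalue_equation_ReIm (el i _ Dt); rewrite mulrAC.
- move=> i; have [CR CI] := Cl i; have d := pd _ CI; apply: is_derive_eq.
  by have [_ ->] := eigenvalue_equation_ReIm (el i _ Dt).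
Qed.

Lemma spectral_path_continuous tau : tau < T -> forall j, {within `[0, tau], continuous
  (spectral_state (fun s => r (s, x s)) (fun i s => l i (s, x s)) j)}.
Proof.
move=> tauT; case: sol => Cr Cl _ _; case: path => _ dx.
have dx' t : 0 <= t < T -> derivable_in `[0, T[ x t 1.
  by move=> tT; have [] := dx t ltac:(by rewrite /= in_itv).
case=> [[[i []]|]|] /=.
- by have [[c _] _] := Cl i; exact: path_continuous dx' c.
- by have [_ [c _]] := Cl i; exact: path_continuous dx' c.
- by move=> s; exact: cst_continuous.
- by case: Cr => c _; exact: path_continuous dx' c.
Qed.

Lemma spectral_path_unique (r' : R -> R) (l' : 'I_2 -> R -> R[i]) :
  (forall (t : R) j, is_derive t 1 (spectral_state r' l' j)
    (quad (spectral_terms k) (spectral_state r' l' ^~ t) (spectral_state r' l' ^~ t) j)) ->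
  r (0, x 0) = r' 0 -> (forall i, l i (0, x 0) = l' i 0) ->
  forall t, 0 <= t < T -> r (t, x t) = r' t /\ forall i, l i (t, x t) = l' i t.
Proof.
move=> d' r0 l0 t /andP[t0 tT].
have E j : spectral_state (fun s => r (s, x s)) (fun i s => l i (s, x s)) j t =
    spectral_state r' l' j t.
  apply: (@quad_solution_unique R _ (spectral_terms k) _ _ t).
  - exact: spectral_path_continuous.
  - by move=> i; exact: is_derive_within_continuous (d' ^~ i).
  - move=> i s /andP[s0 st]; apply: spectral_along_path.
    by rewrite s0 (lt_trans st).
  - by move=> [[[i []]|]|] /=; rewrite ?r0 ?l0.
  - by rewrite t0 lexx.
split; first exact: (E None).
move=> i; have := E (Some (Some (i, true))); have := E (Some (Some (i, false))) => /=.
by case: (l i (t, x t)) (l' i t) => a b [a' b'] /= -> ->.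
Qed.

End AlongPath.

(** * The smooth solution *)

Section LagrangianFields.
Context {R : realType} {P : normedModType R} {J : finType}.
Variables (k : R) (a0 : P -> R) (w : J -> P -> R) (jb jr : J).

(* [None] is the real part [a], [Some None] the constant 1, and the remaining
   unknowns all solve [y' = - 2 a y]. *)
Definition field_terms (i : option (option J)) :
    seq (R * option (option J) * option (option J)) :=
  match i with
  | None => [:: (-1, None, None); (1, Some (Some jb), Some (Some jb));
                (k / 2, Some (Some jr), Some None)]
  | Some None => [::]
  | Some (Some j) => [:: (- 2, None, Some (Some j))]
  end.

Definition field_state (a q : R * P -> R) (i : option (option J)) (p : R * P) :=
  match i with
  | None => a p
  | Some None => 1
  | Some (Some j) => w j p.2 * q p
  end.

(** Everything governed by y' = - 2 a y is its initial value times one common factor q. An arbitrary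
    [J] treats all such fields together, while only [w jb] and [w jr] feed back into the equation of
    a. *)
Lemma lagrangian_fields :
  (forall p, w jb p != 0) ->
  (forall n, Ck_in n setT a0) -> (forall n j, Ck_in n setT (w j)) ->
  exists a q : R * P -> R,
  [/\ forall p, a (0, p) = a0 p /\ q (0, p) = 1,
      forall (t : R) p, is_derive t 1 (fun s => a (s, p))
        (- a (t, p) ^+ 2 + (w jb p * q (t, p)) ^+ 2 + k / 2 * (w jr p * q (t, p))),
      forall (t : R) p, is_derive t 1 (fun s => q (s, p)) (- 2 * (a (t, p) * q (t, p))),
      forall p, exists K, forall t, [/\ `|a (t, p)| <= K, 0 <= q (t, p) & q (t, p) <= K]
    & forall n, Ck_in n setT a /\ forall j, Ck_in n setT (fun p => w j p.2 * q p)].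
Proof.
move=> bn0 Ca Cw.
have /choice[A AP] : forall p, exists aq : (R -> R) * (R -> R),
   [/\ aq.1 0 = a0 p, aq.2 0 = 1,
    forall t, is_derive t (1 : R) aq.1
      (- aq.1 t ^+ 2 + (w jb p * aq.2 t) ^+ 2 + (k / 2 * w jr p) * aq.2 t),
    forall t, is_derive t (1 : R) aq.2 (- 2 * (aq.1 t * aq.2 t))
    & forall t, [/\ `|aq.1 t| <= rate_bound (a0 p) (w jb p) (k / 2 * w jr p), 0 <= aq.2 t
        & aq.2 t <= radius_bound (a0 p) (w jb p) (k / 2 * w jr p) ^+ 2]].
  move=> p; have [a_ [q_ h]] := spectral_ode_solution (a0 p) (k / 2 * w jr p) (bn0 p).
  by exists (a_, q_).
pose a p : R := (A p.2).1 p.1; pose q p : R := (A p.2).2 p.1.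
pose X p := radius_bound (a0 p) (w jb p) (k / 2 * w jr p).
pose Y p := rate_bound (a0 p) (w jb p) (k / 2 * w jr p).
have ca := Ck_continuous (Ca 0%N); have cw j := Ck_continuous (Cw 0%N j).
have cc : continuous (fun p => `|k / 2 * w jr p|).
  by move=> p; apply: cvg_norm; apply: cvgM; [exact: cvg_cst|exact: cw].
have cab : continuous (fun p => a0 p ^+ 2 + w jb p ^+ 2).
  move=> p; apply: cvgD; first exact: (cvgM (ca p) (ca p)).
  exact: (cvgM (cw jb p) (cw jb p)).
have cX : continuous X.
  move=> p; apply: cvgD; first exact: cvg_cst.
  apply: cvgM; last first.
    apply: cvgV; first by rewrite expf_neq0.
    exact: (cvgM (cw jb p) (cw jb p)).
  apply: cvgM; first exact: cvg_cst.
  apply: cvgD; last exact: cvg_cst.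
  by apply: cvgD; [exact: cc|apply: cvgM; [exact: cab|exact: cvg_cst]].
have cX2 : continuous (fun p => X p ^+ 2) by move=> p; exact: (cvgM (cX p) (cX p)).
have cX3 : continuous (fun p => X p ^+ 3).
  by move=> p; exact: (cvgM (cX p) (cX2 p)).
have cY : continuous Y.
  move=> p; apply: cvgD; first apply: cvgD; first exact: cvg_cst.
    by apply: cvgM; [exact: cab|exact: cX2].
  apply: cvgM; first by apply: cvgM; [exact: cvg_cst|exact: cc].
  by apply: cvgD; [exact: cX|exact: cX3].
(* One bound for all unknowns, with 1 for the constant unknown; its continuity in p turns bounds at
   each label into [locally_bounded]. *)
pose B p := 1 + Y p + (\sum_j `|w j p|) * X p ^+ 2.
have cB : continuous B.
  move=> p; apply: cvgD; first by apply: cvgD; [exact: cvg_cst|exact: cY].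
  apply: cvgM; last exact: cX2.
  by apply: cvg_bigsum => j; apply: cvg_norm; exact: cw.
have Y0 p : 0 <= Y p.
  by have [_ _ _ _ /(_ 0)[h _ _]] := AP p; apply: le_trans h.
have SX0 p : 0 <= (\sum_j `|w j p|) * X p ^+ 2.
  by rewrite mulr_ge0 ?sqr_ge0// sumr_ge0.
have bnd p t i : `|field_state a q i (t, p)| <= B p.
  have [_ _ _ _ /(_ t)[h1 h2 h3]] := AP p.
  have := Y0 p; have := SX0 p; rewrite /B; case: i => [[j|]|] /=.
  - have : `|w j p * q (t, p)| <= (\sum_j `|w j p|) * X p ^+ 2.
      rewrite normrM (ger0_norm h2) ler_pM//.
      by rewrite (bigD1 j)//= lerDl sumr_ge0.
    lra.
  - by rewrite normr1; lra.
  - by move: h1; rewrite -/(Y p) /a /=; lra.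
have lb : locally_bounded (field_state a q).
  move=> p T; exists (`|B p| + 1); first by rewrite addr_ge0.
  have : \forall p' \near p, `|B p - B p'| <= 1.
    by have /cvgrPdist_le := cB p; apply.
  apply: filterS => p' pB i t _; apply: le_trans (bnd p' t i) _.
  by move: pB; rewrite ler_norml; have := ler_norm (B p); lra.
have sol : flow_solution field_terms (field_state a q).
  move=> p i t; have [_ _ h1 h2 _] := AP p; rewrite /quad /field_terms.
  case: i => [[j|]|] /=.
  - rewrite big_seq1 /=; have d := h2 t.
    rewrite -[X in is_derive _ _ X _]/(cst (w j p) * (A p).2).
    by apply: is_derive_eq; rewrite /a /q /GRing.scale/=; ring.
  - by rewrite big_nil; exact: is_derive_cst.
  - rewrite !big_cons big_nil /=; have d := h1 t.
    by apply: is_derive_eq; rewrite /a /q /=; ring.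
exists a, q; split.
- by move=> p; have [h1 h2 _ _ _] := AP p.
- by move=> t p; have [_ _ h _ _] := AP p; rewrite mulrA; exact: h.
- by move=> t p; have [_ _ _ h _] := AP p; exact: h.
- move=> p; exists (Y p + X p ^+ 2) => t.
  have [_ _ _ _ /(_ t)[h1 h2 h3]] := AP p; split=> //.
    by apply: le_trans h1 _; rewrite lerDl sqr_ge0.
  by apply: le_trans h3 _; rewrite lerDr.
- move=> n.
  have C i : Ck_in n setT (field_state a q i).
    apply: (Ck_flow sol lb) => -[[j|]|] /=.
    + rewrite (_ : (fun=> _) = w j); first exact: Cw.
      by apply/funext => p; have [_ h _ _ _] := AP p; rewrite /q /= h mulr1.
    + exact: Ck_cst.
    + rewrite (_ : (fun=> _) = a0); first exact: Ca.
      by apply/funext => p; have [h _ _ _ _] := AP p; rewrite /a /= h.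
  by split=> [|j]; [exact: (C None)|exact: (C (Some (Some j)))].
Qed.

End LagrangianFields.

Lemma is_derive_et (R : realType) (f : R * 'rV[R]_2 -> R) (t : R) alpha l :
  is_derive t 1 (fun s => f (s, alpha)) l -> is_derive (t, alpha) et f l.
Proof.
move=> [fd <-].
have cv : h^-1 *: ((f \o shift (t, alpha)) (h *: et) - f (t, alpha))
    @[h --> (0 : R)^'] --> 'D_1 (fun s => f (s, alpha)) t.
  rewrite (_ : (fun h => _) = fun h : R =>
    h^-1 *: (((fun s => f (s, alpha)) \o shift t) (h *: 1) - f (t, alpha))).
    exact: fd.
  apply/funext => h; rewrite /= /et; congr (_ *: (f _ - _)).
  by congr (_, _) => /=; rewrite scaler0 add0r.
by apply: DeriveDef; [exact: cvgP cv|exact: cvg_lim].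
Qed.

Lemma derive_in_et (R : realType) (f : R * 'rV[R]_2 -> R) (t : R) alpha l : 0 <= t ->
  is_derive t 1 (fun s => f (s, alpha)) l ->
  derive_in (slab `[0, +oo[) f et (t, alpha) = l.
Proof.
move=> t0 /is_derive_et[fd <-].
have Dt : slab `[0, +oo[ (t, alpha) by rewrite /slab/= in_itv/= t0.
by have [_ ->] := derive_in_restrict (@accessible_slab R) Dt fd.
Qed.

Lemma derive_in_et_mx (R : realType) (F : R * 'rV[R]_2 -> 'M[R]_2) (t : R) alpha
    (L : 'M[R]_2) : 0 <= t ->
  (forall i j, is_derive t 1 (fun s => F (s, alpha) i j) (L i j)) ->
  derive_in (slab `[0, +oo[) F et (t, alpha) = L.
Proof.
move=> t0 Fd.
have Dt : slab `[0, +oo[ (t, alpha) by rewrite /slab/= in_itv/= t0.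
have dF i j : is_derive (t, alpha) et (fun p => F p i j) (L i j).
  exact: (@is_derive_et R (fun p => F p i j)).
have Fder : derivable F (t, alpha) et by apply/derivable_mxP => i j; have [] := dF i j.
have [_ ->] := derive_in_restrict (@accessible_slab R) Dt Fder.
by rewrite derive_mx//; apply/matrixP => i j; rewrite mxE; have [_ ->] := dF i j.
Qed.

Lemma normc_le (R : realType) (a b : R) : `|a +i* b| <= (`|a| + `|b|)%:C.
Proof.
rewrite lecR -(@ger0_norm _ (`|a| + `|b|)) ?addr_ge0// -sqrtr_sqr ler_wsqrtr//.
rewrite -(real_normK (num_real a)) -(real_normK (num_real b)).
by have := mulr_ge0 (normr_ge0 a) (normr_ge0 b); nra.
Qed.

Lemma sub_scalar_mxE (S : pzRingType) n (A : 'M[S]_n) (a : S) i j :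
  (A - a%:M) i j = A i j - a *+ (i == j).
Proof. by rewrite !mxE. Qed.

Lemma mx22_square_traceless (R : realType) (A : 'M[R]_2) (a b : R) :
  \tr A = a + a -> A 0 0 * A 1 1 - A 0 1 * A 1 0 = a ^+ 2 + b ^+ 2 ->
  (A - a%:M) *m (A - a%:M) = (- b ^+ 2)%:M.
Proof.
rewrite /mxtrace sum_ord2 => tA dA.
have E : A 1 1 = a + a - A 0 0 by rewrite -tA; ring.
apply/matrixP => i j; rewrite !mxE sum_ord2 !mxE.
have [->|->] := ord2_cases i; have [->|->] := ord2_cases j;
  rewrite /= ?mulr1n ?mulr0n ?E; rewrite E in dA; move: dA; move: (A 0 0) (A 0 1) (A 1 0) => x y z; lra.
Qed.

Theorem theorem7p1 (R : realType) (k : R)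
  (u0 : 'rV[R]_2 -> 'rV[R]_2) (rho0 : 'rV[R]_2 -> R)
  (lam0 : 'I_2 -> 'rV[R]_2 -> R[i])
  (smooth_u0 : smooth_in setT u0)
  (smooth_rho0 : smooth_in setT rho0)
  (smooth_lam0 : forall i, smoothC_in setT (lam0 i))
  (rho0_ge0 : forall alpha, 0 <= rho0 alpha)
  (lam0_eigen : forall alpha, eigenvalues_of (grad u0 alpha) (lam0^~ alpha))
  (lam0_complex : forall i alpha, complex.Im (lam0 i alpha) <> 0) :
  (* a smooth solution along all particle paths, for all times t >= 0 ... *)
  exists (rho : R * 'rV[R]_2 -> R) (M : R * 'rV[R]_2 -> 'M[R]_2)
         (lam : 'I_2 -> R * 'rV[R]_2 -> R[i]),
  [/\ [/\ smooth_in (slab `[0, +oo[) rho,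
          smooth_in (slab `[0, +oo[) M
        & forall i, smoothC_in (slab `[0, +oo[) (lam i)],
      lagrangian_solution k `[0, +oo[ rho M lam,
      forall alpha, [/\ rho (0, alpha) = rho0 alpha,
                        M (0, alpha) = grad u0 alpha
                      & forall i, lam i (0, alpha) = lam0 i alpha]
      (* ... with which every classical solution of the spectral system on
         a time interval [0, T[ agrees along its particle paths, and whose
         eigenvalues therefore stay bounded there *)
    & forall (T : R) (u : R * 'rV[R]_2 -> 'rV[R]_2) (r : R * 'rV[R]_2 -> R)
             (l : 'I_2 -> R * 'rV[R]_2 -> R[i]),
        0 < T ->
        spectral_solution k `[0, T[ u r l ->
        (forall alpha, r (0, alpha) = rho0 alpha /\
                       forall i, l i (0, alpha) = lam0 i alpha) ->
        forall (alpha : 'rV[R]_2) (x : R -> 'rV[R]_2),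
        particle_path `[0, T[ u alpha x ->
        (forall t, 0 <= t < T ->
           r (t, x t) = rho (t, alpha) /\
           forall i, l i (t, x t) = lam i (t, alpha)) /\
        (exists C : R, forall i t, 0 <= t < T -> `|l i (t, x t)| <= C%:C)].
Proof.
pose a0 alpha := complex.Re (lam0 0 alpha).
pose b0 alpha := complex.Im (lam0 0 alpha).
have spec alpha := eigenvalues_nonreal (lam0_eigen alpha) (@lam0_complex 0 alpha).
(* Besides b and rho, the four entries of the trace-free part of M also carry the factor q, so the
   matrix equation needs no separate existence argument. *)
pose w (j : bool + 'I_2 * 'I_2) alpha := match j with
  | inl true => b0 alpha
  | inl false => rho0 alpha
  | inr (i, j) => (grad u0 alpha - (a0 alpha)%:M) i j
  end.
have Ca n : Ck_in n setT a0 by have [] := smooth_lam0 0 n.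
have Cw n j : Ck_in n setT (w j).
  case: j => [[]|[i j]]; [by have [] := smooth_lam0 0 n|exact: smooth_rho0|].
  rewrite (_ : w (inr (i, j)) = fun alpha =>
    'D_(delta_mx 0 j) (fun y => u0 y 0 i) alpha + - (i == j)%:R * a0 alpha).
    apply: CkD; last by apply: CkM => //; exact: Ck_cst.
    (* One order of differentiability of [u0] is spent on its gradient. *)
    have /CkSP[_ /(_ (delta_mx 0 j))[_ ]] := Ck_entry 0 i (smooth_u0 n.+1); exact.
  by apply/funext => alpha; rewrite /w !mxE mulNr mulr_natl.
have bn0 alpha : w (inl true) alpha != 0 by apply/eqP; exact: lam0_complex.
have [a [q [init da dq bnd C]]] := lagrangian_fields k (inl false) bn0 Ca Cw.
pose b p := b0 p.2 * q p; pose rho p := rho0 p.2 * q p.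
pose m i j p := w (inr (i, j)) p.2 * q p.
pose M p : 'M[R]_2 := \matrix_(i, j) (a p * (i == j)%:R + m i j p).
pose lam (i : 'I_2) p : R[i] := a p +i* (if i == 0 then b p else - b p).
have dwq alpha (c t : R) : is_derive t 1 (fun s => c * q (s, alpha))
    (- 2 * (a (t, alpha) * (c * q (t, alpha)))).
  have d := dq t alpha.
  rewrite -[X in is_derive _ _ X _]/(cst c * (fun s => q (s, alpha))).
  by apply: is_derive_eq; rewrite /GRing.scale/=; ring.
have drho alpha (t : R) : is_derive t 1 (fun s => rho (s, alpha))
    (- 2 * (a (t, alpha) * rho (t, alpha))) by exact: (dwq alpha (rho0 alpha) t).
have db alpha (t : R) : is_derive t 1 (fun s => b (s, alpha))
    (- 2 * (a (t, alpha) * b (t, alpha))) by exact: (dwq alpha (b0 alpha) t).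
have dm i j alpha (t : R) : is_derive t 1 (fun s => m i j (s, alpha))
    (- 2 * (a (t, alpha) * m i j (t, alpha))).
  exact: (dwq alpha (w (inr (i, j)) alpha) t).
have dre i alpha (t : R) : is_derive t 1 (fun s => complex.Re (lam i (s, alpha)))
    (- complex.Re (lam i (t, alpha)) ^+ 2 + complex.Im (lam i (t, alpha)) ^+ 2 +
     k / 2 * rho (t, alpha)).
  have d := da t alpha; apply: is_derive_eq => /=.
  by case: ifP => _; rewrite ?sqrrN.
have dim i alpha (t : R) : is_derive t 1 (fun s => complex.Im (lam i (s, alpha)))
    (- 2 * (complex.Re (lam i (t, alpha)) * complex.Im (lam i (t, alpha)))).
  rewrite /=; case: ifP => _; first exact: db.
  have d := db alpha t.
  rewrite -[X in is_derive _ _ X _]/(- (fun s => b (s, alpha))).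
  by apply: is_derive_eq; ring.
have acc := @accessible_slab R.
(* With M = a I + m this gives M^2 = (a^2 - b^2) I + 2 a m; the last term cancels m' = - 2 a m, and
   the equation of a remains. *)
have msq alpha t i j : \sum_h m i h (t, alpha) * m h j (t, alpha) =
    - b (t, alpha) ^+ 2 * (i == j)%:R.
  have [_ _ tA dA] := spec alpha.
  have := mx22_square_traceless tA dA => /matrixP/(_ i j).
  rewrite [X in X = _]mxE [X in _ = X]mxE => E.
  rewrite /b exprMn -mulNr mulrAC mulr_natr -/(b0 alpha) -E mulr_suml.
  by apply: eq_bigr => h _; rewrite /m /=; ring.
have m00 alpha t : m 0 0 (t, alpha) + m 1 1 (t, alpha) = 0.
  have [_ _ tA _] := spec alpha.
  move: tA; rewrite /mxtrace sum_ord2 => tA.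
  rewrite /m -mulrDl /w !sub_scalar_mxE !eqxx !mulr1n.
  have -> : forall A B c : R, A + B = c + c -> A - c + (B - c) = 0.
  - by move=> A B c h; lra.
  - by rewrite mul0r.
  - exact: tA.
exists rho, M, lam; split.
- split.
  + by move=> n; apply: Ck_restrict => //; have [_ /(_ (inl false))] := C n.
  + move=> n; apply: Ck_restrict => //; apply: Ck_matrix => i j.
    under eq_fun do rewrite mxE.
    apply: CkD; last by have [_ /(_ (inr (i, j)))] := C n.
    by apply: CkM; [have [] := C n|exact: Ck_cst].
  + move=> i n; have [Can /(_ (inl true)) Cb] := C n.
    have CbN : Ck_in n setT (fun p : R * 'rV[R]_2 => - b p).
      rewrite (_ : (fun p : R * 'rV[R]_2 => - b p) = fun p => -1 * b p).
        by apply: CkM => //; exact: Ck_cst.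
      by apply/funext => p; rewrite mulN1r.
    by split; apply: Ck_restrict => //=; case: (i == 0).
- move=> [t alpha]; rewrite /slab/= in_itv/= andbT => t0.
  have [K /(_ t)[_ q0 _]] := bnd alpha.
  have trM : \tr (M (t, alpha)) = a (t, alpha) + a (t, alpha).
    rewrite /mxtrace sum_ord2 !mxE /= !mulr1.
    by have := m00 alpha t; lra.
  split.
  + by rewrite mulr_ge0.
  + have -> : derive_in (slab `[0, +oo[) M et (t, alpha) =
        \matrix_(i, j) ((- a (t, alpha) ^+ 2 + b (t, alpha) ^+ 2
         + k / 2 * rho (t, alpha)) * (i == j)%:R
         + - 2 * (a (t, alpha) * m i j (t, alpha))).
      apply: derive_in_et_mx => // i j; rewrite mxE; under eq_fun do rewrite mxE.
      have d1 := da t alpha; have d2 := dm i j alpha t.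
      by apply: is_derive_eq; rewrite /GRing.scale/= /b /rho /=; ring.
    apply/matrixP => i j; rewrite mxE [X in X + _ = _]mxE [X in _ + X = _]mxE.
    rewrite [RHS]mxE [X in _ = _ * X]mxE.
    rewrite (eq_bigr (fun h => a (t, alpha) ^+ 2 * ((i == h)%:R * (h == j)%:R) +
      a (t, alpha) * ((i == h)%:R * m h j (t, alpha)) +
      a (t, alpha) * (m i h (t, alpha) * (h == j)%:R) +
      m i h (t, alpha) * m h j (t, alpha))); last first.
      by move=> h _; rewrite !mxE; ring.
    rewrite !big_split/= msq -!mulr_sumr.
    have s1 (f : 'I_2 -> R) : \sum_h (i == h)%:R * f h = f i.
      rewrite (bigD1 i)//= eqxx mul1r big1 ?addr0// => h hi.
      by rewrite eq_sym (negbTE hi) mul0r.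
    have s2 (f : 'I_2 -> R) : \sum_h f h * (h == j)%:R = f j.
      rewrite (bigD1 j)//= eqxx mulr1 big1 ?addr0// => h hi.
      by rewrite (negbTE hi) mulr0.
    by rewrite s1 s1 s2; ring.
  + by rewrite (derive_in_et t0 (drho alpha t)) trM; ring.
  + apply: (@eigenvalues_of_conj R (M (t, alpha)) (lam^~ (t, alpha))
      (a (t, alpha)) (b (t, alpha))) => //.
    rewrite !mxE /=.
    have := msq alpha t 0 0; rewrite sum_ord2 /=.
    have : m 1 1 (t, alpha) = - m 0 0 (t, alpha) by have := m00 alpha t; lra.
    by move=> ->; lra.
  + split.
      rewrite (derive_in_et t0 (drho alpha t)).
      by apply/eqP; rewrite eq_complex/=; apply/andP; split; apply/eqP; ring.
    move=> i; rewrite /deriveC_in (derive_in_et t0 (dre i alpha t)).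
    rewrite (derive_in_et t0 (dim i alpha t)).
    case: (lam i (t, alpha)) => x y; apply/eqP; rewrite eq_complex/=.
    by apply/andP; split; apply/eqP; rewrite ?expr2; field.
- move=> alpha; have [ia iq] := init alpha; have [z0 z1 _ _] := spec alpha; split.
  + by rewrite /rho iq mulr1.
  + by apply/matrixP => i j; rewrite !mxE /m ia iq mulr1 /= !mxE -mulr_natr; ring.
  + move=> i; rewrite /lam /b ia iq mulr1.
    by have [->|->] := ord2_cases i; [rewrite [RHS]z0|rewrite [RHS]z1].
- move=> T u r l T0 sol ini alpha x path.
  have x0 : x 0 = alpha by case: path.
  have agree t : 0 <= t < T ->
      r (t, x t) = rho (t, alpha) /\ forall i, l i (t, x t) = lam i (t, alpha).
    apply: (spectral_path_unique sol path
      (r' := fun t => rho (t, alpha)) (l' := fun i t => lam i (t, alpha))).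
    + move=> s; apply: (@spectral_state_derive R k (fun t => rho (t, alpha))
        (fun i t => lam i (t, alpha)) s).
      have d := drho alpha s; apply: is_derive_eq.
      by rewrite /lam /=; move: (a _) (rho _) => A B; clear; ring.
    + by rewrite x0; have [-> _] := ini alpha; rewrite /rho; have [_ ->] := init alpha; rewrite mulr1.
    + move=> i; rewrite x0; have [_ ->] := ini alpha.
      rewrite /lam /b; have [-> ->] := init alpha; rewrite mulr1.
      by have [z0 z1 _ _] := spec alpha; have [->|->] := ord2_cases i;
        [rewrite [LHS]z0|rewrite [LHS]z1].
  split=> //.
  (* Here |a| <= K and |b| = |b0| q <= |b0| K for all times. *)
  have [K KP] := bnd alpha; exists (K + `|b0 alpha| * K) => i t tT.
  have [_ ->] := agree t tT; apply: le_trans (normc_le _ _) _.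
  have [h1 h2 h3] := KP t; rewrite lecR lerD//.
  have -> : `|if i == 0 then b (t, alpha) else - b (t, alpha)| = `|b0 alpha| * q (t, alpha).
    by case: ifP => _; rewrite ?normrN normrM (ger0_norm h2).
  by rewrite ler_wpM2l.
Qed.
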